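(* Let $n\ge2$, let $z_1,\dots,z_n,m_1,\dots,m_n\in\mathbb C$ and let $l$ be a nonnegative integer. Assume that the pair $\bigl((m_1,0),\dots,(m_n,0)\bigr),\,l$ is separating, i.e. $\sum_{i=1}^nm_i-2l+1+s\ne0$ for all $s=1,\dots,l$. Let $\tau:A_D^*\to\mathrm{Sing}\,W_{a,d}[l]$ be the linear map $g\mapsto(\mathrm{id}\otimes g)(\omega_D)$. Then the image of $\tau$ is $\mathrm{Sing}\,W_{a,d}[l]$ and the kernel of $\tau$ is zero.
   Context: Put $a(u)=\prod_{i=1}^n(u-z_i+m_i)$ and $d(u)=\prod_{i=1}^n(u-z_i)$. Yangian: $Y(\mathfrak{gl}_2)$ is the unital associative complex algebra with generators $T_{ab}^{\{s\}}$, $a,b\in\{1,2\}$, $s\ge1$; with $T_{ab}(u)=\delta_{ab}+\sum_{s\ge1}T_{ab}^{\{s\}}u^{-s}$ its relations are $(u-v)\bigl(T_{ab}(u)T_{cd}(v)-T_{cd}(v)T_{ab}(u)\bigr)=T_{cb}(v)T_{ad}(u)-T_{cb}(u)T_{ad}(v)$. $U(\mathfrak{gl}_2)$ is embedded by $e_{ab}\mapsto T_{ba}^{\{1\}}$. The holomorphic representation $W_{a,d}$ is the vector space $\mathbb C[x_1,\dots,x_n]$ with the unique $Y(\mathfrak{gl}_2)$-action such that $T_{12}(u)\cdot p=\frac1{d(u)}\sum_{i=1}^nu^{n-i}x_i\,p$ for every polynomial $p$, and $T_{11}(u)\cdot1=\frac{a(u)}{d(u)}$, $T_{22}(u)\cdot1=1$,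 $T_{21}(u)\cdot1=0$. $W_{a,d}[l]$ is the subspace of homogeneous polynomials of degree $l$, and $\mathrm{Sing}\,W_{a,d}[l]=\{p\in W_{a,d}[l]\mid e_{12}p=0\}$. Algebra $A_D$: let $\boldsymbol a=(a_1,\dots,a_l)$, $\boldsymbol h=(h_1,\dots,h_n)$ be variables, $p(u,\boldsymbol a)=u^l+a_1u^{l-1}+\dots+a_l$, $B(u,\boldsymbol h)=2u^n+h_1u^{n-1}+\dots+h_n$. Set $q_1=h_1-\sum_{i=1}^n(m_i-2z_i)$, $q_2=h_2-l\bigl(l-1-\sum_{i=1}^nm_i\bigr)-\sum_{1\le i<j\le n}\bigl(z_iz_j+(z_i-m_i)(z_j-m_j)\bigr)$, and for $3\le i\le l+n$ let $q_i(\boldsymbol a,\boldsymbol h)$ be the coefficient of $u^{l+n-i}$ in $d(u)p(u,\boldsymbol a)-B(u,\boldsymbol h)p(u-1,\boldsymbol a)+a(u)p(u-2,\boldsymbol a)$ (when $q_1=q_2=0$ this polynomial has degree at most $l+n-3$ in $u$). Then $A_D=\mathbb C[\boldsymbol a,\boldsymbol h]/I_D$ with $I_D=(q_1,\dots,q_{l+n})$; it is finite-dimensional in the separating case, and $A_D^*$ denotes its dual vector space. Universal weight function: introduce $y_0,\dots,y_{n-1}$ by $\sum_{i=1}^nx_iu^{n-i}=y_0\prod_{j=1}^{n-1}(u-y_j)$, i.e. $x_i=(-1)^{i-1}y_0\sigma_{i-1}(y_1,\dots,y_{n-1})$ with $\sigma_{i-1}$ elementary symmetric. This identifies $W_{a,d}[l]$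 with $y_0^l$ times the space of symmetric polynomials in $y_1,\dots,y_{n-1}$ of degree at most $l$ in each variable. Under this identification $\omega(\boldsymbol y,\boldsymbol a)=y_0^l\prod_{j=1}^{n-1}p(y_j-1,\boldsymbol a)$ is an element of $W_{a,d}[l]\otimes\mathbb C[\boldsymbol a]$, and $\omega_D$ denotes its image in $W_{a,d}[l]\otimes A_D$. In the separating case $\omega_D\in\mathrm{Sing}\,W_{a,d}[l]\otimes A_D$, so $\tau$ is well defined. *)

(* Defs.v *)
From HB Require Import structures.
From mathcomp Require Import all_boot all_order all_algebra.
From mathcomp Require Import boolp reals.
From mathcomp Require Import complex mpoly.

Set Implicit Arguments.
Unset Strict Implicit.
Unset Printing Implicit Defensive.

Import GRing.Theory.
Local Open Scope ring_scope.
Local Open Scope quotient_scope.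

(* Coefficient of u^-s in the expansion at u = oo of the rational function
   f / g: it is the constant term of the polynomial part of u^s f / g. *)
Definition expand_infty (K : fieldType) (f g : {poly K}) (s : nat) : K :=
  (('X^s * f) %/ g)`_0.

Section Yangian.
Variables (K : fieldType) (V : lmodType K).

(* A representation of Y(gl_2) on V: [T a b s] is the operator by which the
   generator T_ab^{s} acts, with T_ab^{0} = delta_ab.  The indices 1, 2 of the
   Yangian are the ordinals 0, 1 of 'I_2.  The second clause is the
   coefficient of u^-r v^-s in the defining relation
     (u - v) [T_ab(u), T_cd(v)] = T_cb(v) T_ad(u) - T_cb(u) T_ad(v);
   the coefficients of u^1 v^-s and u^-r v^1 hold trivially. *)
Definition yangian_action (T : 'I_2 -> 'I_2 -> nat -> {linear V -> V}) :=
  (forall a b v, T a b 0%N v = v *+ (a == b)) /\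
  (forall a b c d r s v,
     (T a b r.+1 (T c d s v) - T c d s (T a b r.+1 v))
     - (T a b r (T c d s.+1 v) - T c d s.+1 (T a b r v))
     = T c b s (T a d r v) - T c b r (T a d s v)).

(* U(gl_2) embeds in Y(gl_2) by e_ab |-> T_ba^{1}. *)
Definition e12 (T : 'I_2 -> 'I_2 -> nat -> {linear V -> V}) : {linear V -> V} :=
  T 1 0 1%N.

End Yangian.

Section Holomorphic.
Variables (K : fieldType) (n l : nat) (z m : 'I_n -> K).

Definition a_poly : {poly K} := \prod_(i < n) ('X - (z i)%:P + (m i)%:P).
Definition d_poly : {poly K} := \prod_(i < n) ('X - (z i)%:P).

Definition separating : Prop :=
  forall s : nat, (1 <= s <= l)%N ->
    \sum_(i < n) m i - 2 * l%:R + 1 + s%:R != 0.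

(* The variables x_1, ..., x_n are 'X_i with i : 'I_n, so u^(n-i) x_i reads
   u^(n.-1-i) 'X_i. *)
Definition holomorphic_rep
    (T : 'I_2 -> 'I_2 -> nat -> {linear {mpoly K[n]} -> {mpoly K[n]}}) :=
  [/\ yangian_action T,
      forall s p, T 0 1 s p =
        \sum_(i < n) expand_infty 'X^(n.-1 - i) d_poly s *: ('X_i * p),
      forall s, T 0 0 s 1 = (expand_infty a_poly d_poly s)%:MP,
      forall s, T 1 1 s 1 = (s == 0%N)%:R
    & forall s, T 1 0 s 1 = 0].

Definition sing
    (T : 'I_2 -> 'I_2 -> nat -> {linear {mpoly K[n]} -> {mpoly K[n]}})
    (p : {mpoly K[n]}) : Prop :=
  p \is l.-homog /\ e12 T p = 0.

End Holomorphic.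

Section AlgebraAD.
Variables (K : fieldType) (n l : nat) (z m : 'I_n -> K).

Local Notation Cah := {mpoly K[l + n]}.

(* a_k and h_k for 1 <= k; they are 0 for k outside 1..l, resp. 1..n. *)
Definition a_var (k : nat) : Cah := \sum_(i < l | i.+1 == k) 'X_(lshift n i).
Definition h_var (k : nat) : Cah := \sum_(i < n | i.+1 == k) 'X_(rshift l i).

Definition p_poly : {poly Cah} :=
  'X^l + \sum_(1 <= k < l.+1) a_var k *: 'X^(l - k).
Definition B_poly : {poly Cah} :=
  2 *: 'X^n + \sum_(1 <= k < n.+1) h_var k *: 'X^(n - k).

Definition difference_poly : {poly Cah} :=
  map_poly (@mpolyC (l + n) K) (d_poly z) * p_poly
  - B_poly * (p_poly \Po ('X - 1))
  + map_poly (@mpolyC (l + n) K) (a_poly z m) * (p_poly \Po ('X - 2%:P)).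

Definition q_rel (k : nat) : Cah :=
  if k == 1%N then
    h_var 1 - (\sum_(i < n) (m i - 2 * z i))%:MP
  else if k == 2%N then
    h_var 2 - (l%:R * (l%:R - 1 - \sum_(i < n) m i))%:MP
      - (\sum_(i < n) \sum_(j < n | (i < j)%N)
           (z i * z j + (z i - m i) * (z j - m j)))%:MP
  else difference_poly`_(l + n - k).

Definition I_D : {pred Cah} := fun f =>
  `[< exists c : nat -> Cah, f = \sum_(1 <= k < (l + n).+1) c k * q_rel k >].

Fact I_D_submod_closed : submod_closed I_D.
Proof.
split=> [|k f g /asboolP[c ->] /asboolP[e ->]]; apply/asboolP.
  by exists (fun=> 0); rewrite big1 // => i _; rewrite mul0r.
exists (fun i => k *: c i + e i); rewrite scaler_sumr -big_split /=.
by apply: eq_bigr => i _; rewrite mulrDl scalerAl.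
Qed.

HB.instance Definition _ :=
  GRing.isSubmodClosed.Build K Cah I_D I_D_submod_closed.

Definition A_D : Type := Quotient.quot I_D.

HB.instance Definition _ := GRing.Zmodule.on A_D.

Definition proj_D : Cah -> A_D := \pi_(Quotient.quot I_D).

Fact proj_D_zmod_morphism : zmod_morphism proj_D.
Proof. exact: raddfB. Qed.

HB.instance Definition _ :=
  GRing.isZmodMorphism.Build Cah A_D proj_D proj_D_zmod_morphism.

Fact eq_proj_D f g : (proj_D f = proj_D g) <-> (f - g \in I_D).
Proof. by rewrite Quotient.idealrBE; split=> /eqP. Qed.

Definition scale_D (k : K) (x : A_D) : A_D :=
  proj_D (k *: repr (x : Quotient.quot I_D)).

Fact proj_D_scale k f : scale_D k (proj_D f) = proj_D (k *: f).
Proof.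
apply/eq_proj_D; rewrite -scalerBr rpredZ //.
by apply/eq_proj_D; rewrite /proj_D reprK.
Qed.

Fact proj_D_surj (x : A_D) : exists f, x = proj_D f.
Proof. by exists (repr (x : Quotient.quot I_D)); rewrite /proj_D reprK. Qed.

Fact scale_DA k k' x : scale_D k (scale_D k' x) = scale_D (k * k') x.
Proof. by have [f ->] := proj_D_surj x; rewrite !proj_D_scale scalerA. Qed.
Fact scale_D1 : left_id 1 scale_D.
Proof. by move=> x; have [f ->] := proj_D_surj x; rewrite proj_D_scale scale1r. Qed.
Fact scale_DDr : right_distributive scale_D +%R.
Proof.
move=> k x y; have [f ->] := proj_D_surj x; have [g ->] := proj_D_surj y.
by rewrite -raddfD !proj_D_scale scalerDr raddfD.
Qed.
Fact scale_DDl x : {morph scale_D^~ x : k k' / k + k'}.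
Proof.
move=> k k'; have [f ->] := proj_D_surj x.
by rewrite !proj_D_scale scalerDl raddfD.
Qed.

HB.instance Definition _ :=
  GRing.Zmodule_isLmodule.Build K A_D scale_DA scale_D1 scale_DDr scale_DDl.

Fact proj_D_scalable : scalable proj_D.
Proof. by move=> k f; rewrite -proj_D_scale. Qed.

HB.instance Definition _ :=
  GRing.isScalable.Build K Cah A_D *:%R proj_D proj_D_scalable.

End AlgebraAD.

Section WeightFunction.
Variables (K : fieldType) (n l : nat).

Local Notation Cah := {mpoly K[l + n]}.

(* C[a, h][y_0, ..., y_(n-1)] with y_0 = 'X_0, and y_j, for 1 <= j <= n - 1,
   given by [y_var j'] with j' = j - 1 : 'I_n.-1. *)
Local Notation Cahy := {mpoly Cah[n.-1.+1]}.
Definition y_var (j : 'I_n.-1) : Cahy := 'X_(lift ord0 j).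

(* The coefficients of y_0 \prod_j (u - y_j): entry i : 'I_n is the coefficient
   of u^(n.-1-i), to be substituted for the i-th variable x_(i+1). *)
Definition x_of_y : n.-tuple Cahy :=
  [tuple ('X_ord0 *: \prod_(j < n.-1) ('X - (y_var j)%:P))`_(n.-1 - i) | i < n].

(* [w] is the element of W[l] (x) C[a, h] = C[a, h][x_1, ..., x_n]_l identified
   with y_0^l \prod_j p(y_j - 1, a); it is unique since substituting [x_of_y] is
   injective. *)
Definition is_weight_function (w : {mpoly Cah[n]}) : Prop :=
  w \is l.-homog /\
  w \mPo x_of_y =
    'X_ord0 ^+ l *
    \prod_(j < n.-1)
       (map_poly (@mpolyC n.-1.+1 Cah) (p_poly K n l)).[y_var j - 1].

(* (id (x) g)(w_D), where w_D has coefficients [proj_D w@_e] on the monomial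
   basis of C[x_1, ..., x_n]. *)
Definition tau (z m : 'I_n -> K) (w : {mpoly Cah[n]}) (g : {scalar A_D l z m}) :
    {mpoly K[n]} :=
  map_mpoly (fun c => g (proj_D z m c)) w.

End WeightFunction.

(* Main.v *)
(* The polynomials p in x_1, ..., x_n are evaluated at the points given by the
   coefficients of X(u) = c \prod_j (u - y_j).  The Yangian relations determine
   the transfer matrix H(u) = d(u) (T_11(u) + T_22(u)) on such points: at a root
   y of X, H(y) p = a(y) p(y -> y - 1) + d(y) p(y -> y + 1).

   For a functional g on A_D let psi_f be the contraction of the weight function
   with c |-> g(f c).  The difference equation defining A_D says that
   H(u) psi_f = psi_{B(u) f}; its coefficient of u^(n-2) expresses that psi_f is
   singular.  Letting the roots y_j go to infinity gives g(f) = +- psi_f(X = 1),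
   and psi_1 = 0 forces psi_f = 0 for all f since A_D is generated by the h_i
   (the a_k are obtained recursively, by the separating condition).

   Conversely, for p singular, C[h] acts on p through the commuting coefficients
   of H, with h_1 and h_2 acting by the prescribed constants.  The difference
   equation in one root y of X, together with the separating condition, shows
   that (f p)(Y(u) (u - y)) = (-1)^l (pi(y - 1) f p)(Y), where the monic
   polynomial pi(u) of degree l with coefficients in C[h] is determined
   recursively.  Hence f |-> +- (f p)(X = 1), with a_k sent to the coefficients
   of pi, kills I_D, and tau sends it to p. *)
From HB Require Import structures.
Require Import Defs.
From mathcomp Require Import all_boot all_order all_algebra.
From mathcomp Require Import boolp reals complex mpoly.
From mathcomp Require Import ring zify.

Set Implicit Arguments.
Unset Strict Implicit.
Unset Printing Implicit Defensive.

Import GRing.Theory Num.Theory.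
Local Open Scope ring_scope.

(** * Multivariate polynomials *)

Lemma mnm_ind (n : nat) (P : 'X_{1..n} -> Prop) :
  P 0%MM -> (forall i m, P m -> P (U_(i) + m)%MM) -> forall m, P m.
Proof.
move=> P0 PU m; move: {2}(mdeg m) (erefl (mdeg m)) => k.
elim: k m => [|k IH] m; first by move/eqP; rewrite mdeg_eq0 => /eqP ->.
move=> dm; have [i mi] : exists i, m i != 0%N.
  apply/existsP; apply: contra_eqT dm; rewrite negb_exists => /forallP m0.
  by rewrite mdegE big1 // => i _; apply/eqP; have := m0 i; rewrite negbK.
rewrite -(@submK _ U_(i) m) ?lep1mP // addmC; apply: PU; apply: IH.
by have := dm; rewrite -{1}(@submK _ U_(i) m) ?lep1mP // mdegD mdeg1 addn1 => -[].
Qed.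

Lemma mpoly_mulX_ind (R : nzRingType) (n : nat) (P : {mpoly R[n]} -> Prop) :
  P 1 -> (forall c p q, P p -> P q -> P (c *: p + q)) ->
  (forall i p, P p -> P ('X_i * p)) -> forall p, P p.
Proof.
move=> P1 PD PX; have P0 : P 0 by have := PD (-1) 1 1 P1 P1; rewrite scaleN1r addNr.
elim/mpolyind=> // c m p _ _ Pp; apply: PD => //; move: m.
by apply: mnm_ind => [|i m Pm]; rewrite ?mpolyX0 // mpolyXD; apply: PX.
Qed.

(** Multiplication by variables reaches every monomial from [1]. Later [L] is a Yangian current at a
    root, recognised in this way as evaluation at a shifted point. *)
Lemma meval_unique (R : comNzRingType) (n : nat) (L : {mpoly R[n]} -> R) (x : 'I_n -> R) :
  (forall c p q, L (c *: p + q) = c * L p + L q) ->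
  (forall i p, L ('X_i * p) = x i * L p) -> forall p, L p = p.@[x] * L 1.
Proof.
move=> Ll LX; apply: mpoly_mulX_ind => [|c p q IHp IHq|i p IHp].
- by rewrite meval1 mul1r.
- by rewrite Ll mevalD mevalZ IHp IHq mulrDl mulrA.
- by rewrite LX IHp mevalM mevalXU mulrA.
Qed.

Lemma poly_natP (K : numFieldType) (p : {poly K}) :
  (forall k : nat, p.[k%:R] = 0) -> p = 0.
Proof.
move=> p0; apply/eqP; apply: contraT => /max_poly_roots.
move/(_ [seq k%:R | k <- iota 0 (size p)]).
rewrite size_map size_iota ltnn => -> //.
  by apply/allP=> _ /mapP[k _ ->]; rewrite rootE p0.
rewrite map_inj_uniq ?iota_uniq // => i j /eqP; by rewrite eqr_nat => /eqP.
Qed.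

Lemma digits_inj (N n : nat) (f g : nat -> nat) :
  (forall i, f i < N)%N -> (forall i, g i < N)%N ->
  (\sum_(i < n) f i * N ^ i = \sum_(i < n) g i * N ^ i)%N ->
  forall i, (i < n)%N -> f i = g i.
Proof.
elim: n f g => // n IH f g fN gN.
have N0 : (0 < N)%N by apply: leq_ltn_trans (fN 0%N).
have split (h : nat -> nat) : (\sum_(i < n.+1) h i * N ^ i =
    (\sum_(i < n) h i.+1 * N ^ i) * N + h 0)%N.
  rewrite big_ord_recl expn0 muln1 addnC; congr addn; rewrite big_distrl /=.
  by apply: eq_bigr => i _; rewrite /bump /= expnSr mulnA.
rewrite !split => E; have E0 : f 0%N = g 0%N.
  by have := congr1 (modn^~ N) E; rewrite /= !modnMDl !modn_small.
have {}E : (\sum_(i < n) f i.+1 * N ^ i = \sum_(i < n) g i.+1 * N ^ i)%N.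
  by move: E; rewrite E0 => /addIn/eqP; rewrite eqn_pmul2r // => /eqP.
by case=> // i lin; exact: (IH (f \o S) (g \o S) (fun j => fN j.+1) (fun j => gN j.+1) E).
Qed.

(* Kronecker substitution: 'X_i |-> t ^ (N ^ i) separates the monomials of p. *)
Lemma meval_eq0 (K : numFieldType) (n : nat) (p : {mpoly K[n]}) :
  (forall v, p.@[v] = 0) -> p = 0.
Proof.
move=> p0; pose N := (msize p).+1.
pose e (m : 'X_{1..n}) := (\sum_(i < n) m i * N ^ i)%N.
pose q := \sum_(m <- msupp p) p@_m *: 'X^(e m) : {poly K}.
have q0 : q = 0.
  apply: poly_natP => k; rewrite -[RHS](p0 (fun i => k%:R ^+ (N ^ i))) mevalE horner_sum.
  apply: eq_bigr => m _; rewrite hornerZ hornerXn /e expr_sum; congr (_ * _).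
  by apply: eq_bigr => i _; rewrite -exprM mulnC.
have e_inj : {in msupp p &, injective e}.
  move=> m m' mp mp' E; apply/mnmP => i.
  (* Exponents are extended by zero to all of [nat]; each is at most the total degree, hence below
     [N]. *)
  pose ext (m0 : 'X_{1..n}) j := if insub j is Some j' then m0 j' else 0%N.
  have extE m0 (j : 'I_n) : ext m0 j = m0 j by rewrite /ext valK.
  have extN m0 j : m0 \in msupp p -> (ext m0 j < N)%N.
    rewrite /ext /N => /msize_mdeg_lt lt0; case: insubP => // j' _ _.
    rewrite ltnS (leq_trans _ (ltnW lt0)) // mdegE (bigD1 j') //=.
    exact: leq_addr.
  rewrite -!extE; apply: (@digits_inj N n) => // [j|j|]; rewrite ?extN //.
  by move: E; rewrite /e; under eq_bigr do rewrite -extE; under [RHS]eq_bigr do rewrite -extE.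
apply/eqP; rewrite -msupp_eq0; apply: contraT => /eqP.
case: (msupp p) (@mcoeff_msupp _ _ p) (msupp_uniq p) e_inj @q q0 => // m0 s sE /andP[m0s _]
  e_inj q.
move/polyP/(_ (e m0)); rewrite /q big_cons coefD coef0 coefZ coefXn eqxx mulr1 coef_sum
  big_seq big1.
  rewrite addr0 => c0; have := sE m0; by rewrite c0 eqxx mem_head.
move=> m ms; rewrite coefZ coefXn; case: eqP => [E|]; last by rewrite mulr0.
by rewrite (e_inj m0 m) ?mem_head ?inE ?ms ?orbT // ms in m0s.
Qed.

(* A polynomial X(u) of degree < n stands for the point of K^n whose
   coordinate x_(k+1) is the coefficient of u^(n-1-k) in X. *)
Definition pt (K : nzRingType) (n : nat) (X : {poly K}) (k : 'I_n) : K := X`_(n.-1 - k).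

Notation roots_poly s := (\prod_(y <- s) ('X - y%:P)).

Lemma horner_mmap (K : comNzRingType) (n : nat) (h : 'I_n -> {poly K}) (p : {mpoly K[n]}) (t :
  K) :
  (mmap polyC h p).[t] = p.@[fun i => (h i).[t]].
Proof.
rewrite (@meval_unique _ _ (fun q => (mmap polyC h q).[t]) (fun i => (h i).[t])).
- by rewrite (rmorph1 (mmap polyC h)) hornerC mulr1.
- by move=> c q r; rewrite mmapD mmapZ hornerD hornerM hornerC.
by move=> i q; rewrite (rmorphM (mmap polyC h)) /= hornerM mmapX mmap1U.
Qed.

(** Coinciding roots are deformed into distinct ones: along [st] the value of [p] is a polynomial in
    [t] that vanishes wherever the roots are distinct, hence identically. *)
Lemma pt_uniq_roots (K : numFieldType) (n : nat) (p : {mpoly K[n]}) (c : K) :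
  (forall s : seq K, size s = n.-1 -> uniq s -> p.@[pt (c *: roots_poly s)] = 0) ->
  forall s : seq K, size s = n.-1 -> p.@[pt (c *: roots_poly s)] = 0.
Proof.
move=> p0 s sz.
(* The roots are made distinct by moving the i-th one to s_i + t i. *)
pose st (t : K) := mkseq (fun i => s`_i + t * i%:R) n.-1.
pose gen : {poly {poly K}} := c%:P *: \prod_(i < n.-1) ('X - ((s`_i)%:P + 'X * i%:R%:P)%:P).
pose Q : {poly K} := mmap polyC (pt gen) p.
have QE t : Q.[t] = p.@[pt (c *: roots_poly (st t))].
  rewrite horner_mmap; apply: meval_eq => k; rewrite /pt.
  suff -> : c *: roots_poly (st t) = map_poly (horner_eval t) gen by rewrite coef_map.
  rewrite /gen map_polyZ (rmorph_prod (map_poly (horner_eval t))) /=.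
  rewrite [horner_eval t _]hornerC; congr (_ *: _).
  rewrite big_map (_ : iota 0 n.-1 = index_iota 0 n.-1) ?big_mkord; last by rewrite
    /index_iota subn0.
  apply: eq_bigr => i _.
  rewrite (rmorphB (map_poly (horner_eval t))) /= map_polyX (map_polyC (horner_eval t)) /=
    /horner_eval hornerD hornerM !hornerC hornerX.
  by [].
(* [D] is the Vandermonde product of the deformed roots. It vanishes when two of them collide, and
   it is nonzero because each factor has linear coefficient [i - j]. *)
pose D : {poly K} := \prod_(i < n.-1) \prod_(j < n.-1 | (i < j)%N)
  ((s`_i - s`_j)%:P + 'X * (i%:R - j%:R)%:P).
have D0 : D != 0.
  apply/prodf_neq0 => i _; apply/prodf_neq0 => j ij; apply/eqP => /polyP/(_ 1%N).
  rewrite coefD coefC coefXM coefC coef0 /= add0r => /eqP; rewrite subr_eq0 eqr_nat.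
  by rewrite ltn_eqF.
have QD : Q * D = 0.
  apply: poly_natP => k; rewrite hornerM QE.
  have [us|] := boolP (uniq (st k%:R)); first by rewrite p0 ?mul0r // size_mkseq.
  case/(uniqPn 0) => i [j []]; rewrite size_mkseq => ij jn.
  have iN := ltn_trans ij jn; rewrite !nth_mkseq // => E.
  rewrite /D horner_prod (bigD1 (Ordinal iN)) //= horner_prod (bigD1 (Ordinal jn)) //=.
  rewrite hornerD hornerM !hornerC hornerX.
  rewrite (_ : _ + _ = 0) ?mul0r ?mulr0 // mulrBr addrACA -opprD E addrN //.
have := QE 0; move/eqP: QD; rewrite mulf_eq0 (negPf D0) orbF => /eqP ->; rewrite horner0.
move=> /esym <-; congr (meval (pt (_ *: \prod_(y <- _) _)) p).
apply: (@eq_from_nth _ 0) => [|i]; first by rewrite size_mkseq.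
by rewrite sz => lt_i; rewrite nth_mkseq // mul0r addr0.
Qed.

Lemma pt_roots_eq0 (K : numClosedFieldType) (n : nat) (p : {mpoly K[n]}) :
  (0 < n)%N ->
  (forall c (s : seq K), size s = n.-1 -> uniq s -> p.@[pt (c *: roots_poly s)] = 0) ->
  p = 0.
Proof.
case: n p => // n p _ p0.
(* ['X_ord0] reads the leading coefficient of [X]. This factor disposes of the points where that
   coefficient vanishes; elsewhere [X] splits into [n] linear factors. *)
suff /eqP : 'X_ord0 * p = 0.
  rewrite mulf_eq0 => /orP[|/eqP //]; rewrite -msupp_eq0 msuppX //.
apply: meval_eq0 => v; rewrite mevalM mevalXU.
have [-> | v0] := eqVneq (v ord0) 0; first by rewrite mul0r.
pose X : {poly K} := \poly_(i < n.+1) v (inord (n - i)).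
have vE : v =1 pt X.
  move=> k; rewrite /pt coef_poly /= ltnS leq_subr subKn; last by rewrite -ltnS.
  by rewrite inord_val.
have szX : size X = n.+1.
  rewrite size_poly_eq //= subnn; suff -> : inord 0 = ord0 :> 'I_n.+1 by [].
  by apply: val_inj; rewrite /= inordK.
have [s Xs] := closed_field_poly_normal X.
rewrite (meval_eq _ vE) Xs (pt_uniq_roots (n := n.+1)) ?mulr0 //.
  by move=> s' ??; apply: p0.
have := szX; rewrite Xs size_scale ?size_prod_XsubC => [[]//|].
by rewrite lead_coef_eq0 -size_poly_eq0 szX.
Qed.

(** * Expansions at infinity *)

Section Expansion.
Variables (K : fieldType) (n : nat) (d : {poly K}).
Hypotheses (d_monic : d \is monic) (size_d : size d = n.+1).
Implicit Types f g : {poly K}.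

Lemma expand_inftyD f g s : expand_infty (f + g) d s = expand_infty f d s + expand_infty g d s.
Proof. by rewrite /expand_infty mulrDr divpD coefD. Qed.

Lemma expand_inftyZ c f s : expand_infty (c *: f) d s = c * expand_infty f d s.
Proof. by rewrite /expand_infty -scalerAr divpZl coefZ. Qed.

Lemma expand_inftyXM f s : expand_infty ('X * f) d s = expand_infty f d s.+1.
Proof. by rewrite /expand_infty exprSr mulrA. Qed.

Lemma expand_infty0 f : (size f <= n)%N -> expand_infty f d 0 = 0.
Proof. by move=> fn; rewrite /expand_infty expr0 mul1r divp_small ?coef0 // size_d. Qed.

(** With ['X^N] split as ['X^j * 'X^(N - j)], the remainder of the second division contributes only
    below degree [j]. So the polynomial part of ['X^N * f / d] lists the expansion of [f / d]
    backwards. *)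
Lemma coef_divp_expand f N j : (size f <= n.+1)%N ->
  (('X^N * f) %/ d)`_j = if (j <= N)%N then expand_infty f d (N - j) else 0.
Proof.
move=> fn; have d0 : d != 0 by rewrite -size_poly_eq0 size_d.
have [jN | Nj] := leqP j N; last first.
  rewrite nth_default // size_divp // size_d (leq_trans _ Nj) //=.
  have [-> | f0] := eqVneq f 0; first by rewrite mulr0 size_poly0.
  by rewrite mulrC size_mulXn //; lia.
rewrite -{1}(subnKC jN) exprD -mulrA.
rewrite {1}(divp_eq ('X^(N - j) * f) d) mulrDr mulrA divpD coefD mulpK //.
rewrite [X in _ + X](_ : _ = 0) ?addr0; first by rewrite coefXnM ltnn subnn.
rewrite nth_default // size_divp // size_d /= leq_subLR.
have lt := ltn_modp ('X^(N - j) * f) d; rewrite d0 size_d in lt.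
have [-> | r0] := eqVneq (('X^(N - j) * f) %% d) 0; first by rewrite mulr0 size_poly0.
by rewrite mulrC size_mulXn // addnC leq_add2r -ltnS lt.
Qed.

(** Coefficient of [u^i], for [i >= 0], in [f = d * (f / d)]. *)
Lemma conv_expand f i : (size f <= n.+1)%N ->
  \sum_(t < n.+1) d`_(i + t) * expand_infty f d t = f`_i.
Proof.
move=> fn; have d0 : d != 0 by rewrite -size_poly_eq0 size_d.
have := congr1 (fun q : {poly K} => q`_(n + i)) (divp_eq ('X^n * f) d).
rewrite coefXnM ltnNge leq_addr /= addKn coefD [X in _ + X]nth_default ?addr0; last first.
  by have := ltn_modp ('X^n * f) d; rewrite d0 size_d ltnS => /leq_trans -> //; lia.
move->; rewrite coefM -(big_mkord xpredT
  (fun j => (('X^n * f) %/ d)`_j * d`_(n + i - j))) (@big_cat_nat _ _ _ n.+1) //=; last by lia.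
rewrite [X in _ + X]big_nat [X in _ + X]big1 ?addr0; last first.
  by move=> j /andP[nj _]; rewrite coef_divp_expand // leqNgt nj mul0r.
rewrite -(big_mkord xpredT (fun t => d`_(i + t) * expand_infty f d t)) big_nat_rev /=.
rewrite !big_nat; apply: eq_bigr => j /andP[_ jn].
rewrite coef_divp_expand // -ltnS jn mulrC add0n subSS; congr (expand_infty _ _ _ * _`_ _).
by lia.
Qed.

(** Coefficient of [u^(-s-1)] in the same identity, where the polynomial [f] contributes nothing. *)
Lemma conv_expand_tail f s : (size f <= n.+1)%N ->
  \sum_(t < n.+1) d`_t * expand_infty f d (s.+1 + t) = 0.
Proof.
move=> fn; have d0 : d != 0 by rewrite -size_poly_eq0 size_d.
have := congr1 (fun q : {poly K} => q`_n) (divp_eq ('X^(n + s.+1) * f) d).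
rewrite coefXnM ifT ?coefD; last by lia.
rewrite [X in _ + X]nth_default ?addr0; last first.
  by have := ltn_modp ('X^(n + s.+1) * f) d; rewrite d0 size_d ltnS.
move=> E; rewrite [RHS]E coefMr; apply: eq_bigr => j _.
rewrite coef_divp_expand // mulrC leq_subLR ifT; last by lia.
by congr (expand_infty _ _ _ * _); have := ltn_ord j; lia.
Qed.

End Expansion.

(** * Yangian currents in separated variables *)

Section RootFormula.
Variables (K : fieldType) (n : nat) (d : {poly K}).
Hypotheses (d_monic : d \is monic) (size_d : size d = n.+1).
Local Notation V := {mpoly K[n]}.

(** The coefficient of [u^-r] in [T_12(u)], which acts by multiplication. The arguments below use
    these combinations of variables because the Yangian relations are stated through them. *)
Definition xser r : V := \sum_(k < n) expand_infty 'X^(n.-1 - k) d r *: 'X_k.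

Lemma size_Xrev (k : 'I_n) : (size ('X^(n.-1 - k) : {poly K}) <= n)%N.
Proof. by rewrite size_polyXn; have := ltn_ord k; lia. Qed.

Lemma xser0 : xser 0 = 0.
Proof. by rewrite /xser big1 // => k _; rewrite (expand_infty0 size_d) ?scale0r // size_Xrev.
  Qed.

Lemma xser_tail s : \sum_(t < n.+1) d`_t *: xser (s.+1 + t) = 0.
Proof.
under eq_bigr do rewrite scaler_sumr; rewrite exchange_big big1 //= => k _.
under eq_bigr do rewrite scalerA; rewrite -scaler_suml.
by rewrite (conv_expand_tail d_monic size_d) ?scale0r // (leq_trans (size_Xrev k)).
Qed.

Lemma mpolyX_xser (k : 'I_n) : 'X_k = \sum_(t < n.+1) d`_(n.-1 - k + t) *: xser t :> V.
Proof.
under eq_bigr do rewrite scaler_sumr; rewrite exchange_big /= (bigD1 k) //= [X in _ + X]big1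
  ?addr0.
  under eq_bigr do rewrite scalerA; rewrite -scaler_suml (conv_expand d_monic size_d).
    by rewrite coefXn eqxx scale1r.
  by rewrite (leq_trans (size_Xrev k)).
move=> i ik; under eq_bigr do rewrite scalerA.
rewrite -scaler_suml (conv_expand d_monic size_d) ?(leq_trans (size_Xrev i)) //.
rewrite coefXn; case: eqP => [E|]; last by rewrite scale0r.
case/eqP: ik; apply: val_inj; have := ltn_ord i; have := ltn_ord k => /=; lia.
Qed.

Lemma meval_xser (X : {poly K}) r : (size X <= n)%N ->
  (xser r).@[pt X] = expand_infty X d r.
Proof.
move=> Xn; rewrite /xser raddf_sum /=; under eq_bigr do rewrite mevalZ mevalXU /pt mulrC.
have XE : X = \sum_(k < n) X`_(n.-1 - k) *: 'X^(n.-1 - k).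
  have {1}-> : X = \poly_(i < n) X`_i.
    by apply/polyP=> i; rewrite coef_poly; case: ltnP => // /(leq_trans Xn) /(nth_default _).
  rewrite poly_def [RHS](reindex_inj rev_ord_inj) /=; apply: eq_bigr => k _.
  have kn := ltn_ord k; rewrite (_ : (n.-1 - (n - k.+1))%N = k) //; lia.
have expand_sum (F : 'I_n -> {poly K}) :
    expand_infty (\sum_k F k) d r = \sum_k expand_infty (F k) d r.
  elim/big_rec2: _ => [|k _ q _ <-]; last by rewrite expand_inftyD.
  by rewrite /expand_infty mulr0 div0p coef0.
by rewrite {2}XE expand_sum; apply: eq_bigr => k _; rewrite expand_inftyZ.
Qed.

Lemma size_mulXsubC_le (Y : {poly K}) (y : K) : (size Y < n)%N -> (size (Y * ('X - y%:P))%R <=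
  n)%N.
Proof.
move=> Yn; have [-> | Y0] := eqVneq Y 0; first by rewrite mul0r size_poly0.
by rewrite size_Mmonic ?monicXsubC // size_XsubC addn2.
Qed.

(** * One diagonal current: [T_11] with [sg = 1], [b = a], or [T_22] with [sg = -1], [b = d] *)

Variables (sg : K) (b : {poly K}) (T : nat -> {linear V -> V}).
Hypothesis size_b : (size b <= n.+1)%N.
Hypothesis T0 : forall p, T 0%N p = p.
Hypothesis T1 : forall s, T s 1 = (expand_infty b d s)%:MP.
Hypothesis Tx : forall r s p,
  (xser r.+1 * T s p - T s (xser r.+1 * p)) - (xser r * T s.+1 p - T s.+1 (xser r * p))
  = sg *: (xser s * T r p - xser r * T s p).

(* The coefficient of u^i in d(u) T(u), for i >= 0. *)
Definition dT i p : V := \sum_(t < n.+1) d`_(i + t) *: T t p.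

(** By [mpolyX_xser] the variables are combinations of the [xser r], so an induction may multiply by
    the latter, whose commutation rules are known. *)
Lemma linear_mulX_ind (Q : V -> Prop) :
  Q 1 -> (forall c p q, Q p -> Q q -> Q (c *: p + q)) ->
  (forall p, Q p -> forall r, Q (xser r * p)) -> forall p, Q p.
Proof.
move=> Q1 QD Qx; apply: mpoly_mulX_ind => // k p Qp.
have Q0 : Q 0 by have := QD (-1) 1 1 Q1 Q1; rewrite scaleN1r addNr.
rewrite mpolyX_xser mulr_suml; elim/big_rec: _ => // t q _ Qq.
by rewrite -scalerAl; apply: QD => //; apply: Qx.
Qed.

(** The exchange relation, convolved with [d], passes the property from [p] and [xser r * p] to
    [xser r.+1 * p]. It makes [d(u) T(u) p] a polynomial in [u]. *)
Lemma dT_tail p s : \sum_(t < n.+1) d`_t *: T (s.+1 + t) p = 0.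
Proof.
elim/linear_mulX_ind: p s => [|c p q IHp IHq|p IH r] s.
- under eq_bigr do rewrite T1 -mul_mpolyC -mpolyCM.
  by rewrite -rmorph_sum /= (conv_expand_tail d_monic size_d) ?mpolyC0.
- under eq_bigr do rewrite linearP scalerDr scalerA mulrC -scalerA.
  by rewrite big_split /= -scaler_sumr IHp IHq scaler0 addr0.
elim: r s => [|r IHr] s.
  by rewrite xser0 mul0r big1 // => t _; rewrite linear0 scaler0.
have : \sum_(t < n.+1) d`_t *: ((xser r.+1 * T (s.+1 + t) p - T (s.+1 + t) (xser r.+1 * p))
      - (xser r * T (s.+2 + t) p - T (s.+2 + t) (xser r * p)))
  = \sum_(t < n.+1) d`_t *: (sg *: (xser (s.+1 + t) * T r p - xser r * T (s.+1 + t) p)).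
  by apply: eq_bigr => t _; rewrite -Tx.
under eq_bigr do rewrite !scalerBr !scalerAr.
under [in RHS]eq_bigr do rewrite scalerA mulrC -scalerA scalerBr scalerAl scalerAr.
rewrite -scaler_sumr !sumrB -!mulr_sumr -mulr_suml xser_tail !IH IHr.
by rewrite !mulr0 mul0r !subrr scaler0 sub0r !subr0 => /eqP; rewrite oppr_eq0 => /eqP.
Qed.

Definition dT_at y p : V := \sum_(i < n.+1) y ^+ i *: dT i p.

(** The left side is the value at [y] of [u d(u) (T(u) - 1) p]. Its constant term is the coefficient
    of [u^-1] in [d(u) T(u) p], which is zero by [dT_tail]. *)
Lemma dT_atS y p : \sum_(i < n.+1) y ^+ i *: (\sum_(t < n.+1) d`_(i + t) *: T t.+1 p) =
  y *: (dT_at y p - d.[y] *: p).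
Proof.
have dn : d`_n = 1 by move/monicP: d_monic; rewrite lead_coefE size_d.
have dlarge i : (n < i)%N -> d`_i = 0 by move=> ni; rewrite nth_default // size_d.
have step i : \sum_(t < n.+1) d`_(i.+1 + t) *: T t.+1 p = dT i p - d`_i *: p.
  rewrite /dT [in RHS]big_ord_recl addn0 T0 [RHS]addrAC subrr add0r big_ord_recr /= dlarge
    ?scale0r ?addr0 //; last by lia.
  by apply: eq_bigr => t _; rewrite /bump /= addSnnS.
rewrite big_ord_recl expr0 scale1r [X in X + _](_ : _ = 0) ?add0r; last first.
  by rewrite -[RHS](dT_tail p 0); apply: eq_bigr => t _; rewrite add0n add1n.
under eq_bigr do rewrite /bump /= step.
rewrite /dT_at horner_coef size_d scaler_suml -sumrB big_ord_recr /=.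
rewrite [X in _ + (X - _)](_ : _ = y ^+ n *: p); last first.
  congr (_ *: _); rewrite /dT big_ord_recl addn0 dn T0 scale1r big1 ?addr0 // => t _.
  by rewrite dlarge ?scale0r // lift0 addnS ltnS leq_addr.
rewrite dn mul1r subrr addr0 scaler_sumr; apply: eq_bigr => i _.
by rewrite scalerBr scalerBr !scalerA exprS [d`_i * _]mulrC mulrA.
Qed.

Lemma dT_at_linear y c p q : dT_at y (c *: p + q) = c *: dT_at y p + dT_at y q.
Proof.
rewrite /dT_at /dT scaler_sumr -big_split /=; apply: eq_bigr => i _.
rewrite scalerA mulrC -scalerA -scalerDr; congr (_ *: _).
rewrite scaler_sumr -big_split /=; apply: eq_bigr => t _.
by rewrite linearP scalerDr !scalerA mulrC.
Qed.

(* The roots of X parametrize the points of K^n (separation of variables); at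
   u = y a root of X, d(u) T(u) only shifts the root y. *)
Lemma root_formula y (Y : {poly K}) p : (size Y < n)%N ->
  (dT_at y p).@[pt (Y * ('X - y%:P))] = b.[y] * p.@[pt (Y * ('X - (y - sg)%:P))].
Proof.
move=> Yn; set X := Y * _; set X' := Y * _; pose L q := (dT_at y q).@[pt X].
have LD c q r : L (c *: q + r) = c * L q + L r by rewrite /L dT_at_linear mevalD mevalZ.
have Ym : (size Y <= n)%N by apply: ltnW.
have evX r : (xser r).@[pt X] = expand_infty Y d r.+1 - y * expand_infty Y d r.
  rewrite meval_xser ?size_mulXsubC_le // /X mulrBr mulrC [Y * _]mulrC mul_polyC.
  by rewrite -scaleNr expand_inftyD expand_inftyXM expand_inftyZ mulNr.
(* Moving the root from [y] to [y - sg] adds [sg * Y] to [X]. *)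
have evX' r : (xser r).@[pt X'] = (xser r).@[pt X] + sg * expand_infty Y d r.
  rewrite meval_xser ?size_mulXsubC_le // /X' mulrBr mulrC [Y * _%:P]mulrC mul_polyC.
  by rewrite -scaleNr expand_inftyD expand_inftyXM expand_inftyZ evX; ring.
(* This sum is the value at [u = y] of [d(u)] times [X(u) / d(u)]. *)
have Xy0 : (\sum_(i < n.+1) y ^+ i *: \sum_(t < n.+1) d`_(i + t) *: xser t).@[pt X] = 0.
  have y0 : X.[y] = 0 by rewrite hornerM hornerXsubC subrr mulr0.
  rewrite -[RHS]y0.
  have szX : (size X <= n)%N by apply: size_mulXsubC_le.
  rewrite (horner_coef_wide _ (leqW szX)) raddf_sum /=; apply: eq_bigr => i _.
  rewrite mevalZ mulrC; congr (_ * _).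
  rewrite raddf_sum /= -[RHS](conv_expand d_monic size_d) ?leqW //.
  by apply: eq_bigr => t _; rewrite mevalZ meval_xser.
(* The exchange relation, convolved with [d] at [u = y], loses its term in [xser t] by [Xy0]; what
   remains determines the action of [xser r.+1] under [L] from that of [xser r]. *)
have Lx r q : L (xser r * q) = (xser r).@[pt X'] * L q.
  elim: r q => [|r IH] q.
    by rewrite xser0 mul0r meval0 mul0r; have := LD (-1) 0 0; rewrite scaler0 addr0 mulN1r
      addNr.
  have : \sum_(i < n.+1) y ^+ i *: (\sum_(t < n.+1) d`_(i + t) *:
      ((xser r.+1 * T t q - T t (xser r.+1 * q))
      - (xser r * T t.+1 q - T t.+1 (xser r * q))))
    = \sum_(i < n.+1) y ^+ i *: (\sum_(t < n.+1) d`_(i + t) *: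
      (sg *: (xser t * T r q - xser r * T t q))).
    by apply: eq_bigr => i _; congr (_ *: _); apply: eq_bigr => t _; rewrite Tx.
  under eq_bigr do under eq_bigr do rewrite !scalerBr !scalerAr.
  under eq_bigr do rewrite !sumrB -!mulr_sumr !scalerBr !scalerAr.
  rewrite !sumrB -!mulr_sumr -/(dT_at y q) -/(dT_at y (xser r.+1 * q)) !dT_atS.
  under [in RHS]eq_bigr do under eq_bigr do rewrite scalerA mulrC -scalerA.
  under [in RHS]eq_bigr do rewrite -scaler_sumr scalerA mulrC -scalerA.
  rewrite -scaler_sumr.
  under [in RHS]eq_bigr do under eq_bigr do rewrite scalerBr scalerAl scalerAr.
  under [in RHS]eq_bigr do rewrite sumrB -mulr_suml -mulr_sumr scalerBr scalerAl scalerAr.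
  rewrite sumrB -mulr_suml -mulr_sumr -/(dT_at y q) => /(congr1 (meval (pt X))).
  rewrite !(mevalB, mevalM, mevalZ) Xy0 mul0r sub0r -/(L q) -/(L (xser r.+1 * q)) -/(L (xser r
    * q)).
  rewrite IH !evX' !evX => E.
  apply/esym/eqP; rewrite -subr_eq0; apply/eqP.
  rewrite -[RHS](subrr (sg * - ((expand_infty Y d r.+1 - y * expand_infty Y d r) * L q)))
    -{1}E.
  ring.
have LX k q : L ('X_k * q) = pt X' k * L q.
  have sumL (F : 'I_n.+1 -> V) : L (\sum_t F t) = \sum_t L (F t).
    elim/big_rec2: _ => [|t u v _ <-]; last by have := LD 1 (F t) v; rewrite scale1r mul1r.
    by have := LD (-1) 0 0; rewrite scaler0 addr0 mulN1r addNr.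
  have ZL c q' : L (c *: q') = c * L q'.
    by have := LD c q' 0; have := LD (-1) 0 0; rewrite scaler0 !addr0 mulN1r addNr => ->;
      rewrite addr0.
  rewrite mpolyX_xser mulr_suml sumL; under eq_bigr do rewrite -scalerAl ZL Lx mulrA.
  rewrite -mulr_suml; congr (_ * _); under eq_bigr do rewrite meval_xser ?size_mulXsubC_le //.
  by rewrite (conv_expand d_monic size_d) // ltnW // ltnS size_mulXsubC_le.
(* [L] is evaluation at the point of [X'] times [L 1], and [L 1] is [b.[y]]. *)
rewrite -/(L p) (@meval_unique _ _ L _ LD LX) mulrC; congr (_ * _).
rewrite /L /dT_at raddf_sum (horner_coef_wide _ size_b) /=; apply: eq_bigr => i _.
rewrite mevalZ mulrC; congr (_ * _); rewrite /dT raddf_sum /= -(conv_expand d_monic size_d) //.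
by apply: eq_bigr => t _; rewrite mevalZ T1 mevalC.
Qed.
End RootFormula.

(** * The transfer matrix *)

Section YangianTrace.
Variables (K : fieldType) (V : lmodType K) (T : 'I_2 -> 'I_2 -> nat -> {linear V -> V}).
Hypothesis TY : yangian_action T.

Definition Ttr s v := T 0 0 s v + T 1 1 s v.

Lemma Ttr_linear s c u v : Ttr s (c *: u + v) = c *: Ttr s u + Ttr s v.
Proof. by rewrite /Ttr !linearP addrACA -scalerDr. Qed.

(** At [r = 0] the operators [T^{0}] are scalars, and the defining relation becomes the action of
    [gl_2] on the currents by commutators. *)
Lemma yangian_gen1 a b c d s v :
  T a b 1%N (T c d s v) - T c d s (T a b 1%N v) = T c b s v *+ (a == d) - T a d s v *+ (c ==
    b).
Proof.
have [T0 TR] := TY; have := TR a b c d 0%N s v.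
by rewrite !T0 !raddfMn /= !mulNrn subrr subr0.
Qed.

(** The right side of the defining relation is antisymmetric in [r] and [s], so it cancels when one
    unit is moved from [r] to [s] on both sides. *)
Lemma T12_T21_sym r s v : T 0 1 r (T 1 0 s v) - T 1 0 s (T 0 1 r v) =
  T 0 1 s (T 1 0 r v) - T 1 0 r (T 0 1 s v).
Proof.
have [T0 TR] := TY; elim: r s => [|r IH] s.
  by rewrite !T0 /= !mulr0n !linear0.
have /eqP := TR 0 1 1 0 r s v; rewrite subr_eq IH => /eqP ->.
have /eqP := TR 0 1 1 0 s r v; rewrite subr_eq => /eqP ->.
by rewrite addrA subrKA subrr add0r.
Qed.

Lemma Tdiag_comm a r s v : T a a r (T a a s v) = T a a s (T a a r v).
Proof.
have [T0 TR] := TY; apply/eqP; rewrite -subr_eq0; apply/eqP; elim: r s => [|r IH] s.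
  by rewrite !T0 eqxx /= subrr.
have /eqP := TR a a a a r s v; rewrite subr_eq IH addr0 => /eqP ->.
by rewrite -opprB IH oppr0.
Qed.

(** Equal diagonal entries commute, so only the mixed commutators matter. Moving one unit from [r]
    to [s] changes their sum by products of [T_12] and [T_21] that cancel by [T12_T21_sym]. *)
Lemma Ttr_comm r s v : Ttr r (Ttr s v) = Ttr s (Ttr r v).
Proof.
have [T0 TR] := TY.
suff E : (T 0 0 r (T 1 1 s v) - T 1 1 s (T 0 0 r v)) + (T 1 1 r (T 0 0 s v) - T 0 0 s (T 1 1 r
  v)) = 0.
  apply/eqP; rewrite -subr_eq0 -{}E /Ttr !raddfD /= (Tdiag_comm 0) (Tdiag_comm 1); apply/eqP.
  have abel (A B C D E F : V) : A + B + (C + D) + (- A - E + (- F - D)) = B - F + (C - E).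
    rewrite addrACA [A + B + _]addrACA [C + D + _]addrACA !subrr add0r addr0.
    by rewrite addrACA [- E - F]addrC addrACA.
  exact: abel.
elim: r s => [|r IH] s.
  by rewrite !T0 /= !subrr addr0.
have /eqP := TR 0 0 1 1 r s v; rewrite subr_eq => /eqP ->.
have /eqP := TR 1 1 0 0 r s v; rewrite subr_eq => /eqP ->.
rewrite addrACA IH addr0 addrACA -opprD; apply/eqP; rewrite subr_eq0.
have /eqP := T12_T21_sym r s v; rewrite subr_eq => /eqP ->.
by rewrite addrA [X in _ == X + _]addrC subrK addrC.
Qed.

Lemma e12_Ttr s v : e12 T (Ttr s v) = Ttr s (e12 T v).
Proof.
apply/eqP; rewrite -subr_eq0 /Ttr /e12 raddfD opprD addrACA !yangian_gen1 /=.
by rewrite !mulr0n !mulr1n sub0r subr0 addNr.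
Qed.
End YangianTrace.

Section TransferMatrix.
Variables (K : numFieldType) (n : nat) (z m : 'I_n -> K).
Variable T : 'I_2 -> 'I_2 -> nat -> {linear {mpoly K[n]} -> {mpoly K[n]}}.
Hypotheses (n_ge2 : (2 <= n)%N) (TH : holomorphic_rep z m T).
Local Notation V := {mpoly K[n]}.
Local Notation d := (d_poly z).
Local Notation a := (a_poly z m).

Lemma d_monic : d \is monic. Proof. exact: monic_prod_XsubC. Qed.

Lemma size_d : size d = n.+1.
Proof. by rewrite size_prod_XsubC /index_enum -enumT size_enum_ord. Qed.

Lemma a_polyE : a = \prod_(i < n) ('X - (z i - m i)%:P).
Proof. by apply: eq_bigr => i _; rewrite polyCB opprB addrA addrAC. Qed.

Lemma a_monic : a \is monic. Proof. by rewrite a_polyE; apply: monic_prod_XsubC. Qed.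

Lemma size_a : size a = n.+1.
Proof. by rewrite a_polyE size_prod_XsubC /index_enum -enumT size_enum_ord. Qed.

Lemma T12E s p : T 0 1 s p = xser n d s * p.
Proof.
have [_ -> _ _ _] := TH; rewrite /xser mulr_suml; apply: eq_bigr => i _.
by rewrite scalerAl.
Qed.

Lemma expand_infty_id s : expand_infty d d s = (s == 0%N)%:R.
Proof. by rewrite /expand_infty mulpK ?monic_neq0 ?d_monic // coefXn eq_sym. Qed.

(* The coefficient of u^i in d(u) (T_11(u) + T_22(u)). *)
Definition Hop i p : V := \sum_(t < n.+1) d`_(i + t) *: Ttr T t p.

Lemma Hop_split i p : Hop i p = dT d (T 0 0) i p + dT d (T 1 1) i p.
Proof. by rewrite /Hop /dT -big_split; apply: eq_bigr => t _; rewrite scalerDr. Qed.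

(** Sum of [root_formula] for [T_11] and for [T_22], which shift the root in opposite directions: a
    Baxter-type difference operator in [y]. *)
Lemma Hop_root y (Y : {poly K}) p : (size Y < n)%N ->
  \sum_(i < n.+1) y ^+ i * (Hop i p).@[pt (Y * ('X - y%:P))] =
  a.[y] * p.@[pt (Y * ('X - (y - 1)%:P))] + d.[y] * p.@[pt (Y * ('X - (y + 1)%:P))].
Proof.
move=> Yn; have [[T0 TR] _ T1a T1d _] := TH.
rewrite -(@root_formula _ _ _ d_monic size_d 1 a (T 0 0)) //; first last.
- move=> r s q; have := TR 0 1 0 0 r s q; rewrite !T12E => ->.
  by rewrite scale1r.
- by rewrite size_a.
have -> : y + 1 = y - -1 by rewrite opprK.
rewrite -(@root_formula _ _ _ d_monic size_d (-1) d (T 1 1)) //; first last.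
- move=> r s q; have := TR 1 1 0 1 s r q; rewrite !T12E scaleN1r opprB.
  by move=> E; rewrite [RHS]opprB -E opprB addrC.
- by move=> s; rewrite T1d expand_infty_id; case: eqP; rewrite ?mpolyC0 ?mpolyC1.
- by rewrite size_d.
rewrite -mevalD /dT_at -big_split /= raddf_sum; apply: eq_bigr => i _.
by rewrite /= -scalerDr mevalZ Hop_split.
Qed.

Lemma Hop_linear i c p q : Hop i (c *: p + q) = c *: Hop i p + Hop i q.
Proof.
rewrite /Hop scaler_sumr -big_split; apply: eq_bigr => t _.
by rewrite Ttr_linear scalerDr !scalerA mulrC.
Qed.

Lemma Hop0 i : Hop i 0 = 0.
Proof. by have := Hop_linear i (-1) 0 0; rewrite scaler0 addr0 scaleN1r addNr. Qed.

Lemma Hop_comm i j p : Hop i (Hop j p) = Hop j (Hop i p).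
Proof.
have [TY _ _ _ _] := TH.
have E i' j' : Hop i' (Hop j' p) =
    \sum_(t < n.+1) \sum_(s < n.+1) (d`_(i' + t) * d`_(j' + s)) *: Ttr T t (Ttr T s p).
  apply: eq_bigr => t _; rewrite /Ttr /Hop !linear_sum -big_split scaler_sumr.
  by apply: eq_bigr => s _; rewrite !linearZ /= -scalerDr scalerA.
rewrite !E exchange_big; apply: eq_bigr => s _; apply: eq_bigr => t _.
by rewrite mulrC (Ttr_comm TY).
Qed.

Lemma e12_Hop i p : e12 T (Hop i p) = Hop i (e12 T p).
Proof.
have [TY _ _ _ _] := TH; rewrite /Hop linear_sum; apply: eq_bigr => t _.
by rewrite linearZ /= (e12_Ttr TY).
Qed.

Lemma Hop1 i : Hop i 1 = ((a + d)`_i)%:MP.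
Proof.
have [_ _ T1a T1d _] := TH.
rewrite coefD -(conv_expand d_monic size_d) ?size_a // -[d`_i](conv_expand d_monic size_d)
  ?size_d //.
rewrite -big_split rmorph_sum; apply: eq_bigr => t _.
rewrite /Ttr T1a T1d (_ : _%:R = (expand_infty d d t)%:MP); last first.
  by rewrite expand_infty_id; case: eqP; rewrite ?mpolyC0 ?mpolyC1.
by rewrite -mpolyCD -mul_mpolyC -mpolyCM mulrDr.
Qed.

Lemma Ttr1_mulX k p : Ttr T 1 ('X_k * p) = 'X_k * Ttr T 1 p.
Proof.
have [TY _ _ _ _] := TH.
have Ex r : Ttr T 1 (xser n d r * p) = xser n d r * Ttr T 1 p.
  apply/eqP; rewrite -subr_eq0 mulrDr -!T12E /Ttr opprD addrACA !(yangian_gen1 TY) /=.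
  by rewrite !mulr0n !mulr1n sub0r subr0 addNr.
rewrite (mpolyX_xser d_monic size_d) !mulr_suml /Ttr !linear_sum -big_split.
by apply: eq_bigr => t _; rewrite -!scalerAl !linearZ /= -scalerDr -Ex.
Qed.

Lemma T22_mulX k p : T 1 1 1%N ('X_k * p) = 'X_k * (T 1 1 1%N p + p).
Proof.
have [TY _ _ _ _] := TH.
have Ex r : T 1 1 1%N (xser n d r * p) = xser n d r * (T 1 1 1%N p + p).
  apply/eqP; rewrite mulrDr -!T12E -subr_eq0 opprD addrA (yangian_gen1 TY) /=.
  by rewrite mulr0n mulr1n subr0 subrr.
rewrite (mpolyX_xser d_monic size_d) !mulr_suml linear_sum.
by apply: eq_bigr => t _; rewrite -!scalerAl linearZ Ex.
Qed.

Lemma T22_mnm mm : T 1 1 1%N 'X_[mm] = (mdeg mm)%:R *: 'X_[mm].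
Proof.
elim/mnm_ind: mm => [|i mm IH].
  by have [_ _ _ T1 _] := TH; rewrite mpolyX0 T1 mdeg0 scale0r.
by rewrite mpolyXD T22_mulX IH mdegD mdeg1 add1n -{2}['X_[mm]]scale1r -scalerDl -natr1
  scalerAr.
Qed.

Lemma mcoeff_T22 p mm : (T 1 1 1%N p)@_mm = (mdeg mm)%:R * p@_mm.
Proof.
have -> : p@_mm = \sum_(k <- msupp p) p@_k * (k == mm)%:R.
  rewrite {1}(mpolyE p) raddf_sum; apply: eq_bigr => k _.
  by rewrite /= mcoeffZ mcoeffX.
rewrite {1}(mpolyE p) linear_sum raddf_sum mulr_sumr; apply: eq_bigr => k _.
rewrite linearZ /= T22_mnm !mcoeffZ mcoeffX.
by case: eqP => [->|]; rewrite ?mulr0 // mulrCA.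
Qed.

(** [T_22^{1}] is the Euler operator, and its eigenvalues on different degrees differ in
    characteristic zero. Operators commuting with it therefore preserve the degree. *)
Lemma dhomog_T22 l p : p \is l.-homog <-> T 1 1 1%N p = l%:R *: p.
Proof.
split=> [/dhomogP pl | E].
  apply/mpolyP => mm; rewrite mcoeff_T22 mcoeffZ.
  have [/pl -> //|/memN_msupp_eq0 ->] := boolP (mm \in msupp p); by rewrite !mulr0.
apply/dhomogP => mm; rewrite mcoeff_msupp => p0; apply/eqP; rewrite -(eqr_nat K).
by rewrite -(inj_eq (mulIf p0)) -mcoeff_T22 E mcoeffZ.
Qed.

Lemma Hop_dhomog l i p : p \is l.-homog -> Hop i p \is l.-homog.
Proof.
have [TY _ _ _ _] := TH.
move/dhomog_T22 => E; apply/dhomog_T22; rewrite /Hop linear_sum scaler_sumr.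
apply: eq_bigr => t _; rewrite linearZ /= !scalerA mulrC -scalerA; congr (_ *: _).
have : T 1 1 1%N (Ttr T t p) - Ttr T t (T 1 1 1%N p) = 0.
  rewrite /Ttr raddfD opprD addrACA !(yangian_gen1 TY) /=.
  by rewrite !mulr0n !mulr1n !subrr addr0.
by move/eqP; rewrite subr_eq0 E => /eqP ->; rewrite /Ttr !linearZ scalerDr.
Qed.

Lemma coef_d_n : d`_n = 1.
Proof. by have /monicP := d_monic; rewrite lead_coefE size_d. Qed.

Lemma coef_d_large i : (n < i)%N -> d`_i = 0.
Proof. by move=> ni; rewrite nth_default // size_d. Qed.

Lemma Ttr0 p : Ttr T 0 p = 2 *: p.
Proof. by have [[T0 _] _ _ _ _] := TH; rewrite /Ttr !T0 scaler_nat. Qed.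

Lemma Hop_top k p : (k <= n)%N ->
  Hop (n - k) p = \sum_(t < k.+1) d`_(n - k + t) *: Ttr T t p.
Proof.
move=> kn; rewrite /Hop -(big_mkord xpredT (fun t => d`_(n - k + t) *: Ttr T t p)).
rewrite (@big_cat_nat _ _ _ k.+1) //= big_mkord [X in _ + X]big_nat [X in _ + X]big1 ?addr0 //.
by move=> t /andP[kt _]; rewrite coef_d_large ?scale0r //; lia.
Qed.

Lemma Hop_n p : Hop n p = 2 *: p.
Proof. by have := @Hop_top 0 p isT; rewrite subn0 big_ord1 addn0 coef_d_n scale1r Ttr0. Qed.

Lemma Hop_n1E p : Hop n.-1 p = (2 * d`_n.-1) *: p + Ttr T 1 p.
Proof.
have n1 : (1 <= n)%N := ltnW n_ge2; have := @Hop_top 1 p n1.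
rewrite subn1 !big_ord_recl big_ord0 addr0 addn0 Ttr0 scalerA mulrC => ->.
by rewrite lift0 addn1 prednK // coef_d_n scale1r.
Qed.

(** [T_11^{1} + T_22^{1}] commutes with all variables, hence is multiplication by its value at [1],
    a constant read off from [Hop1]. *)
Lemma Hop_n1 p : Hop n.-1 p = (a + d)`_n.-1 *: p.
Proof.
suff E : Ttr T 1 p = p * Ttr T 1 1.
  rewrite Hop_n1E E; have /eqP := Hop_n1E 1; rewrite addrC -subr_eq => /eqP <-.
  by rewrite Hop1 mulrBr -scalerAr mulr1 [p * _]mulrC mul_mpolyC addrC subrK.
elim/mpoly_mulX_ind: p => [|c p q IHp IHq|i p IH]; first by rewrite mul1r.
  by rewrite Ttr_linear IHp IHq mulrDl scalerAl.
by rewrite Ttr1_mulX IH mulrA.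
Qed.

Lemma Hop_n2E p : Hop (n - 2) p =
  (2 * d`_(n - 2)) *: p + d`_n.-1 *: Ttr T 1 p + Ttr T 2 p.
Proof.
have [-> E2] : n.-1 = (n - 2 + 1)%N /\ (n - 2 + 2)%N = n by split; lia.
rewrite Hop_top // !big_ord_recl big_ord0 addr0 addn0 Ttr0 scalerA mulrC addrA.
by rewrite !lift0 E2 coef_d_n scale1r.
Qed.

Lemma Ttr1E p : Ttr T 1 p = (a`_n.-1 - d`_n.-1) *: p.
Proof.
have /eqP := Hop_n1E p; rewrite addrC -subr_eq Hop_n1 -scalerBl coefD => /eqP <-.
by congr (_ *: _); ring.
Qed.

Lemma mpolyX0_xser (i0 : 'I_n) : val i0 = 0%N -> 'X_i0 = xser n d 1 :> V.
Proof.
move=> i00; have n1 : (1 <= n)%N := ltnW n_ge2.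
rewrite (mpolyX_xser d_monic size_d) i00 subn0.
rewrite -(big_mkord xpredT (fun t => d`_(n.-1 + t) *: xser n d t)).
rewrite (@big_cat_nat _ _ _ 2) //= [X in _ + X]big_nat [X in _ + X]big1 ?addr0; last first.
  by move=> t /andP[kt _]; rewrite coef_d_large ?scale0r //; lia.
rewrite big_mkord !big_ord_recl big_ord0 addr0 addn0 (xser0 d_monic size_d) scaler0 add0r.
by rewrite lift0 addn1 prednK // coef_d_n scale1r.
Qed.

(* The quantum determinant gives T_11^{2} + T_22^{2} - T_12^{1} T_21^{1} as a
   scalar on each degree; here it is obtained from its commutators with x_k. *)
Lemma Ttr2_mulX l k p : p \is l.-homog ->
  Ttr T 2 ('X_k * p) - xser n d 1 * e12 T ('X_k * p) =
  'X_k * (Ttr T 2 p - xser n d 1 * e12 T p) + (2 * l%:R - (a`_n.-1 - d`_n.-1)) *: ('X_k * p).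
Proof.
move=> pl; have [TY T01 _ _ T10] := TH; have [T0 TR] := TY.
have T22l := (dhomog_T22 l p).1 pl.
have T11l : T 0 0 1%N p = (a`_n.-1 - d`_n.-1 - l%:R) *: p.
  by have /eqP := Ttr1E p; rewrite /Ttr T22l eq_sym -subr_eq -scalerBl => /eqP <-.
set M := a`_n.-1 - d`_n.-1 in T11l *.
have T11xl r : T 0 0 1%N (xser n d r * p) = (M - l%:R - 1) *: (xser n d r * p).
  have /eqP := yangian_gen1 TY 0 0 0 1 r p; rewrite !T12E T11l /= mulr0n mulr1n sub0r.
  rewrite subr_eq addrC -scalerAr => /eqP ->.
  by rewrite [RHS]scalerBl scale1r.
(* [lin] derives an identity from a known one once [ring] has checked that both have the same
   difference of sides. *)
have lin (x y u v : V) : u = v -> x - y = u - v -> x = y.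
  by move=> ->; rewrite subrr => /subr0_eq.
have Ex r : Ttr T 2 (xser n d r * p) - xser n d 1 * e12 T (xser n d r * p) =
    xser n d r * (Ttr T 2 p - xser n d 1 * e12 T p) + (2 * l%:R - M) *: (xser n d r * p).
  have E0 : T 0 0 2 (xser n d r * p) = xser n d r * T 0 0 2 p - xser n d r.+1 * p
       + T 0 0 r (xser n d 1 * p) - T 0 0 1%N (xser n d r * p).
    have := TR 0 0 0 1 1%N r p; rewrite (yangian_gen1 TY) /= !T12E mulr0n mulr1n => H.
    by apply: lin H _; ring.
  have E1 : T 1 1 2 (xser n d r * p) = xser n d r * T 1 1 2 p + xser n d r.+1 * p
       + xser n d r * T 1 1 1%N p - xser n d 1 * T 1 1 r p.
    have := TR 1 1 0 1 1%N r p; rewrite (yangian_gen1 TY) /= !T12E mulr0n mulr1n => H.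
    by apply: lin H _; ring.
  have E2 : T 0 0 r (xser n d 1 * p) = xser n d 1 * T 0 0 r p - xser n d r * p.
    have := yangian_gen1 TY 0 1 0 0 r p; rewrite !T12E /= mulr0n mulr1n => /esym H.
    by apply: lin H _; ring.
  have E3 : e12 T (xser n d r * p) = xser n d r * e12 T p + T 0 0 r p - T 1 1 r p.
    have := yangian_gen1 TY 1 0 0 1 r p; rewrite !T12E /= !mulr1n -/(e12 T) => H.
    by apply: lin H _; ring.
  rewrite /Ttr E0 E1 E2 E3 T11xl T22l -!mul_mpolyC.
  rewrite !(mpolyCB, mpolyCM, mpolyC1, mpolyC_nat).
  by ring.
rewrite (mpolyX_xser d_monic size_d); elim/big_rec: _ => [|t x _ IH].
  by rewrite !mul0r scaler0 addr0 linear0 mulr0 subr0 /Ttr !linear0 addr0.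
rewrite mulrDl -scalerAl Ttr_linear linearP /=.
have H := congr2 (fun u v : V => (d`_(n.-1 - k + t))%:MP * u + v) (Ex t) IH.
by apply: lin H _; rewrite -!mul_mpolyC /=; ring.
Qed.

(** The eigenvalue of [Hop (n - 2)] on singular vectors of degree [l]; [h2cE] matches it with the
    constant subtracted from [h_2] in [q_2]. *)
Definition h2c l : K := (a + d)`_(n - 2) + l%:R * (l%:R - 1 + d`_n.-1 - a`_n.-1).

(** [G] below acts as a scalar on each degree, by induction on monomials through [Ttr2_mulX].
    Singularity thus becomes an eigenvalue condition on [Hop (n - 2)]. *)
Lemma e12_eq l (i0 : 'I_n) p : val i0 = 0%N -> p \is l.-homog ->
  'X_i0 * e12 T p = Hop (n - 2) p - h2c l *: p.
Proof.
move=> i00 pl; have [[T0 _] _ _ T1d T10] := TH.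
pose G q := Ttr T 2 q - xser n d 1 * e12 T q.
have Hop2 q : Hop (n - 2) q = G q + xser n d 1 * e12 T q +
    (2 * d`_(n - 2) + d`_n.-1 * (a`_n.-1 - d`_n.-1)) *: q.
  by rewrite Hop_n2E Ttr1E scalerA scalerDl [G _ + _]subrK addrC.
(* The scalar by which [G] acts on [1], obtained from [Hop1] and [T_21(u) 1 = 0]. *)
pose c0 := (a + d)`_(n - 2) - (2 * d`_(n - 2) + d`_n.-1 * (a`_n.-1 - d`_n.-1)).
have Gm mm : G 'X_[mm] = (c0 + (mdeg mm)%:R * ((mdeg mm)%:R - 1 + d`_n.-1 - a`_n.-1)) *:
  'X_[mm].
  elim/mnm_ind: mm => [|k mm IH].
    rewrite mdeg0 mul0r addr0 mpolyX0; have := Hop2 1.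
    rewrite Hop1 /e12 T10 mulr0 addr0 => /eqP; rewrite -subr_eq => /eqP <-.
    by rewrite -mul_mpolyC -[_ *: 1]mul_mpolyC !mulr1 -mpolyCB.
  rewrite mpolyXD /G (@Ttr2_mulX (mdeg mm)) ?dhomogX // -/(G _) IH -scalerAr -scalerDl.
  by rewrite mdegD mdeg1 natrD; congr (_ *: _); ring.
rewrite Hop2 -(mpolyX0_xser i00).
have -> : G p = (c0 + l%:R * (l%:R - 1 + d`_n.-1 - a`_n.-1)) *: p.
  have GD c u v : G (c *: u + v) = c *: G u + G v.
    by rewrite /G Ttr_linear linearP mulrDr -scalerAr opprD addrACA -scalerBr.
  have G0 : G 0 = 0 by rewrite /G /Ttr !linear0 mulr0 addr0 subr0.
  have -> : p = \sum_(k <- msupp p) p@_k *: 'X_[k] by rewrite -mpolyE.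
  rewrite scaler_sumr big_seq [RHS]big_seq; elim/big_rec2: _ => // k u v kp <-.
  rewrite GD Gm (dhomog_mf pl kp) !scalerA [p@_k * _]mulrC addrC; congr (_ + _).
rewrite /c0 /h2c -!mul_mpolyC !(mpolyCB, mpolyCD).
ring.
Qed.
End TransferMatrix.

(** * The difference equation *)

Section TopCoefficients.
Variable P : comNzRingType.
Implicit Types p q : {poly P}.

(** The terms of [p] in degrees [N.+2], [N.+1] and [N], possibly zero; the explicit remainder lets
    products be checked by [ring]. *)
Definition top3 N p (c0 c1 c2 : P) :=
  exists2 r : {poly P}, (size r <= N)%N & p = r + 'X^N * (c2%:P + c1 *: 'X + c0 *: 'X^2).

Lemma top3_intro N p : (size p <= N.+3)%N -> top3 N p p`_N.+2 p`_N.+1 p`_N.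
Proof.
move=> sp; exists (\poly_(i < N) p`_i); first exact: size_poly.
apply/polyP=> i; rewrite coefD coef_poly coefXnM.
have [iN | Ni] := ltnP i N; first by rewrite addr0.
rewrite !coefD coefC !coefZ coefX coefXn add0r.
case E : (i - N)%N => [|[|[|k]]] /=; rewrite ?mulr0 ?mulr1 ?addr0 ?add0r.
- by congr (_ `_ _); lia.
- by congr (_ `_ _); lia.
- by congr (_ `_ _); lia.
by rewrite nth_default // (leq_trans sp) //; lia.
Qed.

Lemma top3_coef N p c0 c1 c2 i : top3 N p c0 c1 c2 -> (N <= i)%N ->
  p`_i = if i == N then c2 else if i == N.+1 then c1 else if i == N.+2 then c0 else 0.
Proof.
move=> [r sr ->] Ni; rewrite coefD nth_default ?(leq_trans sr) // add0r.
rewrite coefXnM ltnNge Ni /= !coefD coefC !coefZ coefX coefXn.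
have -> : (i == N) = (i - N == 0)%N by lia.
have -> : (i == N.+1) = (i - N == 1)%N by lia.
have -> : (i == N.+2) = (i - N == 2)%N by lia.
by case: (i - N)%N => [|[|[|k]]] /=; rewrite ?mulr0 ?mulr1 ?addr0 ?add0r.
Qed.

Lemma top3B N p q c0 c1 c2 e0 e1 e2 : top3 N p c0 c1 c2 -> top3 N q e0 e1 e2 ->
  top3 N (p - q) (c0 - e0) (c1 - e1) (c2 - e2).
Proof.
move=> [r sr ->] [s ss ->]; exists (r - s).
  by rewrite (leq_trans (size_polyD _ _)) // geq_max sr size_polyN.
by rewrite polyCB -!mul_polyC !polyCB; ring.
Qed.

Lemma top3D N p q c0 c1 c2 e0 e1 e2 : top3 N p c0 c1 c2 -> top3 N q e0 e1 e2 ->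
  top3 N (p + q) (c0 + e0) (c1 + e1) (c2 + e2).
Proof.
move=> [r sr ->] [s ss ->]; exists (r + s).
  by rewrite (leq_trans (size_polyD _ _)) // geq_max sr.
by rewrite polyCD -!mul_polyC !polyCD; ring.
Qed.

Lemma size_quad (c0 c1 c2 : P) : (size (c2%:P + c1 *: 'X + c0 *: 'X^2)%R <= 3)%N.
Proof.
rewrite (leq_trans (size_polyD _ _)) // geq_max (leq_trans (size_polyD _ _)).
  by rewrite (leq_trans (size_scale_leq _ _)) ?size_polyXn.
rewrite geq_max (leq_trans (size_polyC_leq1 _)) //.
by rewrite (leq_trans (size_scale_leq _ _)) ?size_polyX.
Qed.

Lemma size_mul_le p q i j : (size p <= i)%N -> (size q <= j)%N -> (size (p * q)%R <= (i +
  j).-1)%N.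
Proof. by move=> pi qj; rewrite (leq_trans (size_polyMleq _ _)) //; lia. Qed.

Lemma top3M N M p q c0 c1 c2 e0 e1 e2 : top3 N p c0 c1 c2 -> top3 M q e0 e1 e2 ->
  top3 (N + M).+2 (p * q) (c0 * e0) (c0 * e1 + c1 * e0) (c0 * e2 + c1 * e1 + c2 * e0).
Proof.
move=> [r sr ->] [s ss ->].
set Q := _ + c0 *: _; set R := _ + e0 *: _.
exists (r * s + 'X^M * (r * R) + 'X^N * (s * Q) +
  'X^(N + M) * ((c2 * e2)%:P + (c2 * e1 + c1 * e2) *: 'X)).
  have sXn k (u : {poly P}) j : (size u <= j)%N -> (size ('X^k * u)%R <= k + j)%N.
    by move=> uj; rewrite (leq_trans (size_mul_le (leqnn _) uj)) // size_polyXn; lia.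
  have sD (u v : {poly P}) k : (size u <= k)%N -> (size v <= k)%N -> (size (u + v)%R <= k)%N.
    by move=> uk vk; rewrite (leq_trans (size_polyD _ _)) // geq_max uk.
  apply: (sD _ _ _ (sD _ _ _ (sD _ _ _ _ _) _) _).
  - by rewrite (leq_trans (size_mul_le sr ss)) //; lia.
  - by rewrite (leq_trans (sXn _ _ _ (size_mul_le sr (size_quad _ _ _)))) //; lia.
  - by rewrite (leq_trans (sXn _ _ _ (size_mul_le ss (size_quad _ _ _)))) //; lia.
  rewrite (leq_trans (sXn _ _ 2 _)) //; last by lia.
  rewrite (leq_trans (size_polyD _ _)) // geq_max (leq_trans (size_polyC_leq1 _)) //.
  by rewrite (leq_trans (size_scale_leq _ _)) ?size_polyX.
rewrite /Q /R -!mul_polyC !(polyCD, polyCM) -(addn2 (N + M)) !exprD.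
by ring.
Qed.

(** The factor ['X^2] leaves room for three coefficients even when [r < 2]. Multiplying by one more
    ['X - c], Pascal's rule gives the binomial. *)
Lemma top3_XsubC (c : P) r :
  top3 r ('X^2 * ('X - c%:P) ^+ r) 1 (- (c * r%:R)) (c ^+ 2 * 'C(r, 2)%:R).
Proof.
elim: r => [|r [s sr E]].
  exists 0; rewrite ?size_poly0 // !mulr0 oppr0 scale0r scale1r polyC0 !add0r expr0.
  by rewrite mulr1 mul1r.
exists (s * ('X - c%:P) - (c ^+ 3 * 'C(r, 2)%:R) *: 'X^r).
  rewrite (leq_trans (size_polyD _ _)) // geq_max size_polyN.
  rewrite (leq_trans (size_mul_le sr (leqnn _))) ?size_XsubC; last by lia.
  by rewrite (leq_trans (size_scale_leq _ _)) ?size_polyXn.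
rewrite [_ ^+ r.+1]exprSr mulrA {}E binS bin1 natrD -natr1 -!mul_polyC.
rewrite !(polyCD, polyCM, polyCN, polyC1) !exprS.
ring.
Qed.

End TopCoefficients.

Section DifferenceOperator.
Variable P : comNzRingType.
Implicit Types (d a b p q : {poly P}).

Definition Dop d a b p := d * p - b * (p \Po ('X - 1)) + a * (p \Po ('X - 2%:P)).

Lemma Dop_linear d a b c p q : Dop d a b (c *: p + q) = c *: Dop d a b p + Dop d a b q.
Proof. by rewrite /Dop !comp_polyD !comp_polyZ -!mul_polyC; ring. Qed.

Lemma Dop_sum d a b (I : Type) (s : seq I) (c : I -> P) (F : I -> {poly P}) :
  Dop d a b (\sum_(i <- s) c i *: F i) = \sum_(i <- s) c i *: Dop d a b (F i).
Proof.
elim/big_rec2: _ => [|i u v _ IH]; first by rewrite /Dop !comp_poly0 !mulr0 subr0 addr0.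
by rewrite Dop_linear IH.
Qed.

Lemma Dop_change d a b b' p :
  Dop d a b p = Dop d a b' p + (b' - b) * (p \Po ('X - 1)).
Proof. by rewrite /Dop; ring. Qed.

Lemma horner_Dop d a b p x :
  (Dop d a b p).[x] = d.[x] * p.[x] - b.[x] * p.[x - 1] + a.[x] * p.[x - 2].
Proof. by rewrite /Dop !(hornerD, hornerN, hornerM) !horner_comp -polyC1 !hornerXsubC. Qed.

(** The leading terms cancel as [1 - 2 + 1 = 0], the next ones because [b] has second coefficient
    [a1 + d1]. The factor ['X^2] moves all degrees up by two. *)
Lemma top3_Dop n r d a b (d1 d2 a1 a2 h2 : P) : (2 <= n)%N ->
  top3 (n - 2) d 1 d1 d2 -> top3 (n - 2) a 1 a1 a2 -> top3 (n - 2) b 2 (a1 + d1) h2 ->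
  top3 (n + r) ('X^2 * Dop d a b 'X^r) 0 0
    (a2 + d2 - h2 + r%:R * (r%:R - 1 + d1 - a1)).
Proof.
move=> n2 td ta tb.
have tX := top3_XsubC (0 : P) r; rewrite subr0 mul0r oppr0 expr0n mul0r in tX.
have := top3D (top3B (top3M td tX) (top3M tb (top3_XsubC 1 r))) (top3M ta (top3_XsubC 2 r)).
rewrite (_ : (n - 2 + r).+2 = n + r)%N; last by lia.
have -> : 'X^2 * Dop d a b 'X^r = d * ('X^2 * 'X^r) - b * ('X^2 * ('X - 1%:P) ^+ r) +
    a * ('X^2 * ('X - 2%:P) ^+ r).
  by rewrite /Dop !comp_Xn_poly; ring.
have C2 : 'C(r, 2)%:R * 2 = r%:R * (r%:R - 1) :> P.
  case: r {tX} => [|r]; first by rewrite !mul0r.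
  by rewrite -natrM mulnC -mul_bin_diag bin1 natrM [in RHS]mulrS; ring.
congr (top3 _ _ _ _ _); rewrite ?mulr1 ?mul1r ?mulr0 ?addr0 ?add0r; first by ring.
  by ring.
have -> : r%:R * (r%:R - 1 + d1 - a1) = r%:R * (r%:R - 1) + r%:R * (d1 - a1) by ring.
by rewrite -C2; ring.
Qed.

End DifferenceOperator.

Lemma map_XsubC2 (P Q : comNzRingType) (f : {rmorphism P -> Q}) :
  map_poly f ('X - 2%:P) = 'X - 2%:P.
Proof.
have two (R : comNzRingType) : 2%:P = 2 :> {poly R} by rewrite rmorph_nat.
by rewrite !two rmorphB rmorph_nat /= map_polyX.
Qed.

Lemma map_XsubC1 (P Q : comNzRingType) (f : {rmorphism P -> Q}) :
  map_poly f ('X - 1) = 'X - 1.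
Proof. by rewrite rmorphB /= map_polyX rmorph1. Qed.

(** Keeps [b] apart from the factors defined over [P]: the coefficients of the result are affine in
    those of [b], with constants in the image of [f]. *)
Lemma Dop_Xn_map (P Q : comNzRingType) (f : {rmorphism P -> Q}) d a (b : {poly Q}) r :
  Dop (map_poly f d) (map_poly f a) b 'X^r = map_poly f (d * 'X^r)
    - b * map_poly f (('X - 1) ^+ r) + map_poly f (a * ('X - 2%:P) ^+ r).
Proof.
by rewrite /Dop !comp_Xn_poly !rmorphM /= !rmorphXn /= map_polyX map_XsubC1 map_XsubC2.
Qed.

Lemma map_Dop (P Q : comNzRingType) (f : {rmorphism P -> Q}) d a b p :
  map_poly f (Dop d a b p) =
  Dop (map_poly f d) (map_poly f a) (map_poly f b) (map_poly f p).
Proof.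
by rewrite /Dop rmorphD rmorphB !rmorphM /= !map_comp_poly map_XsubC1 map_XsubC2.
Qed.

Lemma top3_monic (K P : comNzRingType) (f : {rmorphism K -> P}) n (q : {poly K}) :
  (2 <= n)%N -> q \is monic -> size q = n.+1 ->
  top3 (n - 2) (map_poly f q) 1 (f q`_n.-1) (f q`_(n - 2)).
Proof.
move=> n2 /monicP qm sq; have := @top3_intro _ (n - 2) (map_poly f q).
rewrite !coef_map /= (leq_trans (size_poly _ _)) ?sq //; last by lia.
have [-> ->] : (n - 2).+2 = n /\ (n - 2).+1 = n.-1 by split; lia.
by move: qm; rewrite lead_coefE sq /= => ->; rewrite rmorph1; apply.
Qed.

(** * Triangular systems with invertible scalar diagonal *)

Section TriangularRecursion.
Variables (K : fieldType) (P : comAlgType K) (l : nat).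
Variables (E : nat -> nat -> P) (e : nat -> K).
Hypothesis Ediag : forall k, (1 <= k <= l)%N -> E k k = (e k)%:A.
Hypothesis e_neq0 : forall k, (1 <= k <= l)%N -> e k != 0.

Lemma triangular_solution : exists2 c : nat -> P, c 0%N = 1 &
  forall k, (1 <= k <= l)%N -> \sum_(j < k.+1) c j * E k j = 0.
Proof.
suff [c c0 cE] : exists2 c : nat -> P, c 0%N = 1 &
    forall k, (1 <= k <= l)%N -> (k <= l)%N -> \sum_(j < k.+1) c j * E k j = 0.
  by exists c => // k kl; apply: cE => //; case/andP: kl.
elim: {1}l => [|L [c c0 IH]]; first by exists (fun=> 1) => // k; lia.
pose s := \sum_(j < L.+1) c j * E L.+1 j.
exists (fun j => if j == L.+1 then - (e L.+1)^-1 *: s else c j) => // k /andP[k1].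
rewrite leq_eqVlt => /orP[/eqP -> Ll|kL kl]; last first.
  rewrite -[RHS](IH k) ?k1 //; apply: eq_bigr => j _; rewrite ltn_eqF //.
  by have := ltn_ord j; lia.
rewrite big_ord_recr /= eqxx Ediag ?Ll // -scalerAl -scalerAr mulr1 scalerA mulNr mulVf
  ?e_neq0 ?Ll //.
rewrite scaleN1r; apply/eqP; rewrite subr_eq0; apply/eqP; apply: eq_bigr => j _.
by rewrite ltn_eqF // ltn_ord.
Qed.

Variables (c : nat -> P) (phi : nat -> {scalar P}).
Hypothesis c0 : c 0%N = 1.
Hypothesis cE : forall k, (1 <= k <= l)%N -> \sum_(j < k.+1) c j * E k j = 0.
Hypothesis phiE : forall k f, (1 <= k <= l)%N -> \sum_(j < k.+1) phi j (E k j * f) = 0.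

(** The functionals [phi k] satisfy the same recursion as the elements [c k], and the nonzero
    diagonal leaves no freedom: [phi] is determined by [phi 0]. *)
Lemma triangular_unique k f : (k <= l)%N -> phi k f = phi 0%N (c k * f).
Proof.
elim/ltn_ind: k f => -[|k] IH f kl; first by rewrite c0 mul1r.
have kk : (1 <= k.+1 <= l)%N by rewrite kl.
apply: (mulfI (e_neq0 kk)); rewrite -!scalarZ.
have /eqP := phiE f kk; rewrite big_ord_recr /= Ediag // -scalerAl mul1r addrC addr_eq0 =>
  /eqP ->.
have /eqP := cE kk; rewrite big_ord_recr /= Ediag // -scalerAr mulr1 addrC addr_eq0 => /eqP E1.
rewrite scalerAl E1 mulNr linearN mulr_suml linear_sum; congr (- _); apply: eq_bigr => j _.
by rewrite IH ?mulrA // ltnW // (leq_trans (ltn_ord j)).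
Qed.
End TriangularRecursion.

(** * Homogeneous polynomials restricted to lines *)

Section Lines.
Variables (K : comNzRingType) (n : nat).
Implicit Types (p : {mpoly K[n]}) (X Y : {poly K}).

Lemma dhomog_meval_scale l p (c : K) X :
  p \is l.-homog -> p.@[pt (c *: X)] = c ^+ l * p.@[pt X].
Proof.
move=> pl; rewrite !mevalE mulr_sumr big_seq [RHS]big_seq; apply: eq_bigr => k kp.
have <- : mdeg k = l := dhomog_mf pl kp.
rewrite mulrCA; congr (_ * _); rewrite mdegE expr_sum -big_split.
by apply: eq_bigr => i _; rewrite /= -exprMn /pt coefZ.
Qed.

(** A monomial of degree [l] becomes a product of [l] linear factors in the parameter, whose top
    coefficient only sees the direction [w]. *)
Lemma mmap_line l p (v w : 'I_n -> K) (h := fun k => (v k)%:P + w k *: 'X) :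
  p \is l.-homog -> (size (mmap polyC h p) <= l.+1)%N /\ (mmap polyC h p)`_l = p.@[w].
Proof.
move=> pl; have mono k : (size (mmap1 h k) <= (mdeg k).+1)%N /\ (mmap1 h k)`_(mdeg k) = (mmap1
  w k).
  elim/mnm_ind: k => [|i k [IHs IHc]]; first by rewrite mdeg0 !mmap11 size_poly1 coefC.
  rewrite !commr_mmap1_M ?mmap1U; try by move=> ??; apply: mulrC.
  rewrite mdegD mdeg1 add1n; split.
    apply: (size_mul_le (i := 2) _ IHs).
    rewrite (leq_trans (size_polyD _ _)) // geq_max (leq_trans (size_polyC_leq1 _)) //.
    by rewrite (leq_trans (size_scale_leq _ _)) ?size_polyX.
  rewrite /h mulrDl coefD coefCM -scalerAl coefZ coefXM /= IHc [X in _ * X]nth_default ?mulr0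
    ?add0r //.
have kl k : k \in msupp p -> mdeg k = l by move=> kp; apply: (dhomog_mf pl kp).
rewrite mevalE /mmap big_seq [X in _ = X]big_seq; split.
  elim/big_rec: _ => [|k u kp IH]; first by rewrite size_poly0.
  rewrite (leq_trans (size_polyD _ _)) // geq_max IH andbT mul_polyC.
  rewrite (leq_trans (size_scale_leq _ _)) //.
  by rewrite -(kl k kp); case: (mono k).
rewrite coef_sum; apply: eq_bigr => k kp.
by rewrite coefCM -(kl k kp) (mono k).2.
Qed.

(* The restriction of p to the points X(u) = Y(u) (u - 1 - s), as a polynomial
   in s: the top coefficient comes from the root escaping to infinity. *)
Definition line Y p : {poly K} :=
  mmap polyC (fun k => (pt (Y * ('X - 1)) k)%:P + (pt (- Y) k) *: 'X) p.

Lemma horner_line Y p s : (line Y p).[s] = p.@[pt (Y * ('X - (s + 1)%:P))].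
Proof.
rewrite horner_mmap; apply: meval_eq => k; rewrite hornerD hornerC hornerZ hornerX /pt.
have -> : Y * ('X - (s + 1)%:P) = Y * ('X - 1) - s *: Y.
  by rewrite -mul_polyC polyCD polyC1; ring.
by rewrite coefB coefZ coefN mulNr [_ * s]mulrC.
Qed.

Lemma size_line l Y p : p \is l.-homog -> (size (line Y p) <= l.+1)%N.
Proof. by move=> pl; case: (mmap_line (pt (Y * ('X - 1))) (pt (- Y)) pl). Qed.

Lemma coef_line l Y p : p \is l.-homog -> (line Y p)`_l = (-1) ^+ l * p.@[pt Y].
Proof.
move=> pl; case: (mmap_line (pt (Y * ('X - 1))) (pt (- Y)) pl) => _ ->.
by rewrite -scaleN1r (dhomog_meval_scale _ _ pl).
Qed.

Lemma line_linear Y c p q : line Y (c *: p + q) = c *: line Y p + line Y q.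
Proof. by rewrite /line mmapD mmapZ mul_polyC. Qed.

End Lines.

(** * Polynomials in commuting operators *)

Section Action.
Variables (K : fieldType) (V : lmodType K) (n : nat) (theta : 'I_n -> V -> V).
Hypothesis theta_linear : forall i c u v, theta i (c *: u + v) = c *: theta i u + theta i v.
Hypothesis theta_comm : forall i j v, theta i (theta j v) = theta j (theta i v).

Lemma mpoly_action (v : V) : exists act : {mpoly K[n]} -> V,
  [/\ forall c f g, act (c *: f + g) = c *: act f + act g, act 1 = v &
      forall i f, act ('X_i * f) = theta i (act f)].
Proof.
(* A monomial acts by iterating the operators in the order of [enum 'I_n]; commutativity brings one
   more factor [theta i] to its place. *)
pose w (m : 'X_{1..n}) := foldr (fun i u => iter (m i) (theta i) u) v (enum 'I_n).
have wU i m : w (U_(i) + m)%MM = theta i (w m).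
  have : i \in enum 'I_n by rewrite mem_enum.
  have iterC j k u : iter k (theta j) (theta i u) = theta i (iter k (theta j) u).
    by elim: k => //= k ->; rewrite theta_comm.
  rewrite /w; elim: (enum 'I_n) (enum_uniq 'I_n) => //= j s IH /andP[js us].
  rewrite inE mnmDE mnm1E => /orP[/eqP E|i_s].
    subst j; rewrite eqxx add1n iterS; congr (theta i (iter _ _ _)).
    elim: s js {IH us} => //= k s IH; rewrite inE negb_or => /andP[ik js].
    by rewrite IH // mnmDE mnm1E (negPf ik).
  by rewrite IH // (_ : (i == j) = false) ?add0n ?iterC //; apply: contraNF js => /eqP <-.
pose act f := \sum_(m <- msupp f) f@_m *: w m.
have actE f k : (msize f <= k)%N -> act f = \sum_(m : 'X_{1..n < k}) f@_m *: w m.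
  move=> fk; pose I : subFinType _ := 'X_{1..n < k}.
  rewrite /act (ssrcomplements.big_mksub I) ?msupp_uniq //=; last first.
    by move=> x /msize_mdeg_lt /leq_trans; apply.
  by rewrite big_rmcond //= => i /memN_msupp_eq0 ->; rewrite scale0r.
have actD c f g : act (c *: f + g) = c *: act f + act g.
  pose k := maxn (msize (c *: f + g)) (maxn (msize f) (msize g)).
  rewrite !(actE _ k) ?leq_max ?leqnn ?orbT // scaler_sumr -big_split.
  by apply: eq_bigr => m _; rewrite mcoeffD mcoeffZ scalerDl scalerA.
have actX m : act 'X_[m] = w m by rewrite /act msuppX big_seq1 mcoeffX eqxx scale1r.
have act0 : act 0 = 0 by rewrite /act msupp0 big_nil.
have theta0 i : theta i 0 = 0.
  by have := theta_linear i (-1) 0 0; rewrite scaler0 addr0 scaleN1r addNr.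
exists act; split => //.
  rewrite -mpolyX0 actX /w; elim: (enum _) => //= i s ->; by rewrite mnm0E.
move=> i f; elim/mpolyind: f => [|c m f _ _ IH]; first by rewrite mulr0 act0 theta0.
by rewrite mulrDr -scalerAr -mpolyXD !actD theta_linear IH !actX wU.
Qed.
End Action.

(** * Subleading coefficients of [a] and [d] as elementary symmetric functions *)

Lemma top3_prod_XsubC (P : comNzRingType) n (x : nat -> P) :
  top3 n ('X^2 * \prod_(i < n) ('X - (x i)%:P)) 1 (- \sum_(i < n) x i)
    (\sum_(i < n) \sum_(j < n | (i < j)%N) x i * x j).
Proof.
elim: n => [|n [s sn E]].
  exists 0; rewrite ?size_poly0 // !big_ord0 !mulr1 oppr0 scale0r scale1r.
  by rewrite polyC0 !add0r expr0 mul1r.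
set e2 := \sum_(i < n) _ in E; set e1 := \sum_(i < n) _ in E.
exists (s * ('X - (x n)%:P) - (x n * e2) *: 'X^n).
  rewrite (leq_trans (size_polyD _ _)) // geq_max size_polyN.
  rewrite (leq_trans (size_mul_le sn (leqnn _))) ?size_XsubC; last by lia.
  by rewrite (leq_trans (size_scale_leq _ _)) ?size_polyXn.
have -> : \sum_(i < n.+1) \sum_(j < n.+1 | (i < j)%N) x i * x j = e2 + x n * e1.
  rewrite big_ord_recr /= [X in _ + X]big1 ?addr0; last first.
    by move=> j; rewrite ltnNge -ltnS ltn_ord.
  rewrite /e2 /e1 mulr_sumr -big_split; apply: eq_bigr => i _.
  rewrite big_mkcond big_ord_recr /= ltn_ord -big_mkcond [x n * _]mulrC.
  by [].
rewrite !big_ord_recr /= mulrA E -/e1 -!mul_polyC.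
rewrite !(polyCD, polyCM, polyCN, polyC1) !exprS.
by ring.
Qed.

Section Constants.
Variables (K : numFieldType) (n : nat).
Hypothesis n_ge2 : (2 <= n)%N.

Lemma coef_prod_top (x : 'I_n -> K) (q := \prod_(i < n) ('X - (x i)%:P)) :
  q`_n.-1 = - \sum_(i < n) x i /\
  q`_(n - 2) = \sum_(i < n) \sum_(j < n | (i < j)%N) x i * x j.
Proof.
pose x' k := oapp x 0 (insub k).
have xE (i : 'I_n) : x' i = x i by rewrite /x' valK.
have -> : \sum_(i < n) x i = \sum_(i < n) x' i by apply: eq_bigr => i _; rewrite xE.
have -> : \sum_(i < n) \sum_(j < n | (i < j)%N) x i * x j =
    \sum_(i < n) \sum_(j < n | (i < j)%N) x' i * x' j.
  by apply: eq_bigr => i _; apply: eq_bigr => j _; rewrite !xE.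
have qE : q = \prod_(i < n) ('X - (x' i)%:P) by apply: eq_bigr => i _; rewrite xE.
have tq := top3_prod_XsubC n x'; rewrite -qE in tq.
have := top3_coef tq (leqnn _); have := top3_coef tq (leqnSn _).
have E1 : (n.+1 - 2 = n.-1)%N by lia.
have N1 : (n < 2)%N = false by lia.
have N2 : (n.+1 < 2)%N = false by lia.
have N3 : (n.+1 == n) = false by lia.
by rewrite !coefXnM !eqxx N1 N2 N3 E1 => -> ->.
Qed.

Variables (z m : 'I_n -> K).
Local Notation d := (d_poly z).
Local Notation a := (a_poly z m).

Lemma coef_ad_n1 : (a + d)`_n.-1 = \sum_(i < n) (m i - 2 * z i).
Proof.
rewrite coefD a_polyE (coef_prod_top _).1 (coef_prod_top _).1 -opprD -big_split -sumrN.
by apply: eq_bigr => i _ /=; ring.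
Qed.

Lemma coef_a_sub_d : a`_n.-1 - d`_n.-1 = \sum_(i < n) m i.
Proof.
rewrite a_polyE (coef_prod_top _).1 (coef_prod_top _).1 opprK addrC -sumrB.
by apply: eq_bigr => i _ /=; ring.
Qed.

Lemma h2cE l : h2c z m l = l%:R * (l%:R - 1 - \sum_(i < n) m i) +
  \sum_(i < n) \sum_(j < n | (i < j)%N) (z i * z j + (z i - m i) * (z j - m j)).
Proof.
rewrite /h2c -coef_a_sub_d addrC coefD a_polyE (coef_prod_top _).2 [in X in _ + (_ +
  X)](coef_prod_top _).2.
congr (_ + _); first by congr (_ * _); ring.
rewrite addrC -big_split; apply: eq_bigr => i _; by rewrite -big_split.
Qed.

End Constants.

(** The sum is a polynomial in [y] vanishing at all natural numbers. This converts the difference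
    equation, known at each value of [u], into equations between coefficients. *)
Lemma functionals_coef_eq0 (K : numFieldType) (N k : nat)
    (g : 'I_k -> {mpoly K[N]} -> K) (q : 'I_k -> {poly {mpoly K[N]}}) :
  (forall j c u v, g j (c *: u + v) = c * g j u + g j v) ->
  (forall y : K, \sum_(j < k) g j (q j).[y%:MP] = 0) ->
  forall i, \sum_(j < k) g j (q j)`_i = 0.
Proof.
move=> gD g0 i.
have gz j : g j 0 = 0.
  by have := gD j (-1) 0 0; rewrite scaler0 addr0 mulN1r addNr.
have gs j (I : Type) (s : seq I) (c : I -> K) (F : I -> {mpoly K[N]}) :
    g j (\sum_(i <- s) c i *: F i) = \sum_(i <- s) c i * g j (F i).
  by elim/big_rec2: _ => [|i' u v _ <-]; rewrite ?gz ?gD.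
pose R := \sum_(j < k) \poly_(i < size (q j)) g j (q j)`_i.
suff /(congr1 (fun r : {poly K} => r`_i)) : R = 0.
  rewrite coef0 coef_sum => {2}<-; apply: eq_bigr => j _; rewrite coef_poly.
  by case: ltnP => // /(nth_default _) ->.
apply: poly_natP => y; rewrite -[RHS](g0 y%:R) horner_sum; apply: eq_bigr => j _.
rewrite horner_poly horner_coef (eq_bigr (fun i : 'I__ => (y%:R ^+ i) *: (q j)`_i)); last
  first.
  by move=> i' _; rewrite -mul_mpolyC rmorphXn /= mulrC.
by rewrite gs; apply: eq_bigr => i' _; rewrite mulrC.
Qed.

(** * The recursion that the difference equation imposes in one root *)

Section Recursion.
Variables (K : numFieldType) (N n l : nat) (z m : 'I_n -> K).
Hypothesis n_ge2 : (2 <= n)%N.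
Local Notation P := {mpoly K[N]}.
Local Notation d := (d_poly z).
Local Notation a := (a_poly z m).
Local Notation iota := (map_poly (@mpolyC N K)).

(** [B_poly] with arbitrary entries for the [h_k], so that the first two can be replaced by their
    constants. *)
Definition betaP (hv : 'I_n -> P) : {poly P} :=
  2 *: 'X^n + \sum_(k < n) hv k *: 'X^(n.-1 - k).

Lemma coef_betaP_n hv : (betaP hv)`_n = 2.
Proof.
rewrite coefD coefZ coefXn eqxx mulr1 coef_sum big1 ?addr0 // => k _.
by rewrite coefZ coefXn gtn_eqF ?mulr0 //; have := ltn_ord k; lia.
Qed.

Lemma coef_betaP hv (k : 'I_n) : (betaP hv)`_(n.-1 - k) = hv k.
Proof.
have kn := ltn_ord k; rewrite coefD coefZ coefXn ltn_eqF ?mulr0 ?add0r; last by lia.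
rewrite coef_sum (bigD1 k) //= coefZ coefXn eqxx mulr1 big1 ?addr0 // => j jk.
rewrite coefZ coefXn; case: eqP => [E|]; last by rewrite mulr0.
by case/eqP: jk; apply: val_inj; have := ltn_ord j; move=> /=; lia.
Qed.

Lemma size_betaP hv : (size (betaP hv) <= n.+1)%N.
Proof.
rewrite (leq_trans (size_polyD _ _)) // geq_max (leq_trans (size_scale_leq _ _)) ?size_polyXn
  //=.
rewrite (leq_trans (size_sum _ _ _)) //; apply/bigmax_leqP => k _.
by rewrite (leq_trans (size_scale_leq _ _)) // size_polyXn; lia.
Qed.

Variable hv : 'I_n -> P.
Hypothesis hv0 : forall k : 'I_n, val k = 0%N -> hv k = ((a + d)`_n.-1)%:MP.
Hypothesis hv1 : forall k : 'I_n, val k = 1%N -> hv k = (h2c z m l)%:MP.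
Local Notation D := (Dop (iota d) (iota a) (betaP hv)).

(** With [h_1] and [h_2] constant, [top3_Dop] leaves a quadratic polynomial in [r]; the value [h2c]
    makes [r = l] one of its roots. *)
Lemma coef_Dop_X r i : (n + r - 2 <= i)%N ->
  (D 'X^r)`_i = if i == (n + r - 2)%N
    then ((r%:R - l%:R) * (r%:R + l%:R - 1 - \sum_(i < n) m i))%:MP else 0.
Proof.
move=> ri; have n0 : (0 < n)%N by lia. have n1 : (1 < n)%N by [].
have td := top3_monic (@mpolyC N K) n_ge2 (d_monic z) (size_d z).
have ta := top3_monic (@mpolyC N K) n_ge2 (a_monic z m) (size_a z m).
have tb : top3 (n - 2) (betaP hv) 2 ((a`_n.-1)%:MP + (d`_n.-1)%:MP) (h2c z m l)%:MP.
  have := @top3_intro _ (n - 2) (betaP hv).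
  have E2 : ((n - 2).+2 = n)%N by lia.
  have E1 : ((n - 2).+1 = n.-1 - Ordinal n0)%N by move=> /=; lia.
  have E0 : (n - 2 = n.-1 - Ordinal n1)%N by move=> /=; lia.
  rewrite E2 E1 {2}E0 coef_betaP_n !coef_betaP hv0 // hv1 // coefD mpolyCD; apply.
  by rewrite (leq_trans (size_betaP _)) //; lia.
have := top3_coef (i := i.+2) (top3_Dop r n_ge2 td ta tb).
rewrite coefXnM /= subn2 => -> //; last by lia.
have -> : (i.+2 == n + r)%N = (i == n + r - 2)%N by lia.
case: eqP => _; last by rewrite !if_same.
rewrite /h2c -(coef_a_sub_d n_ge2 z m) -!(mpolyC_nat, mpolyC1) -!(mpolyCD, mpolyCB, mpolyCM).
by congr (_%:MP); rewrite coefD; ring.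
Qed.

(** The matrix of the difference operator with degrees counted down from the top. It is triangular,
    and its diagonal [ediag] is [k] times the quantity in [separating]. *)
Definition Ecoef k j : P := (D 'X^(l - j))`_(l + n - 2 - k).
Definition ediag k : K := k%:R * (\sum_(i < n) m i - 2 * l%:R + 1 + k%:R).

Lemma Ecoef_diag k : (k <= l)%N -> Ecoef k k = (ediag k)%:A.
Proof.
move=> kl; rewrite alg_mpolyC /Ecoef coef_Dop_X; last by lia.
rewrite (_ : (_ == _) = true); last by lia.
by congr (_%:MP); rewrite /ediag natrB //; ring.
Qed.

Lemma Ecoef_low k j : (k < j)%N -> (j <= l)%N -> Ecoef k j = 0.
Proof.
move=> kj jl; rewrite /Ecoef coef_Dop_X; last by lia.
by rewrite (_ : (_ == _) = false) //; lia.
Qed.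

Lemma coef_Dop_sum c i : (D (\sum_(j < l.+1) c j *: 'X^(l - j)))`_i =
  \sum_(j < l.+1) c j * (D 'X^(l - j))`_i.
Proof. by rewrite Dop_sum coef_sum; apply: eq_bigr => j _; rewrite coefZ. Qed.

Lemma coef_Dop_sum_high c i : (l + n - 2 <= i)%N ->
  (D (\sum_(j < l.+1) c j *: 'X^(l - j)))`_i = 0.
Proof.
move=> li; rewrite coef_Dop_sum big1 // => j _; have jl := ltn_ord j.
rewrite coef_Dop_X; last by lia.
case: eqP => [E|]; last by rewrite mulr0.
by rewrite (_ : (l - j)%N = l) ?subrr ?mul0r ?mpolyC0 ?mulr0 //; lia.
Qed.

Lemma big_Ecoef (U : zmodType) k (F : nat -> P -> U) : (forall j, F j 0 = 0) -> (k <= l)%N ->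
  \sum_(j < l.+1) F j (D 'X^(l - j))`_(l + n - 2 - k) = \sum_(j < k.+1) F j (Ecoef k j).
Proof.
move=> F0 kl; rewrite -(big_mkord xpredT (fun j => F j (D 'X^(l - j))`_(l + n - 2 - k))).
rewrite (@big_cat_nat _ _ _ k.+1) //= big_mkord [X in _ + X]big_nat [X in _ + X]big1 ?addr0 //.
by move=> j /andP[kj jl]; rewrite -/(Ecoef k j) Ecoef_low.
Qed.


Variable T : 'I_2 -> 'I_2 -> nat -> {linear {mpoly K[n]} -> {mpoly K[n]}}.
Hypothesis TH : holomorphic_rep z m T.
Hypothesis sep : separating l m.

Lemma ediag_neq0 k : (1 <= k <= l)%N -> ediag k != 0.
Proof.
move=> kl; rewrite mulf_neq0 ?sep // pnatr_eq0; by case/andP: kl; case: k.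
Qed.

Variable psi : P -> {mpoly K[n]}.
Hypothesis psi_linear : forall c f g, psi (c *: f + g) = c *: psi f + psi g.
Hypothesis psi_homog : forall f, psi f \is l.-homog.
Hypothesis psi_Hop : forall i f, (i <= n)%N -> Hop z T i (psi f) = psi ((betaP hv)`_i * f).

Lemma psi0 : psi 0 = 0.
Proof. by have := psi_linear (-1) 0 0; rewrite scaler0 addr0 scaleN1r addNr. Qed.

(** Indexed from the top, so that [lcoef Y 0] is, up to sign, the value at [Y] itself, the remaining
    root having gone to infinity. *)
Definition lcoef (Y : {poly K}) j f : K := (line Y (psi f))`_(l - j).

Lemma lcoef_linear Y j c f g : lcoef Y j (c *: f + g) = c * lcoef Y j f + lcoef Y j g.
Proof. by rewrite /lcoef psi_linear line_linear coefD coefZ. Qed.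

Lemma lcoefZ Y j c f : lcoef Y j (c *: f) = c * lcoef Y j f.
Proof. by have := lcoef_linear Y j c f 0; rewrite addr0 /lcoef psi0 /line mmap0 coef0 addr0.
  Qed.

Lemma lcoef0 Y f : lcoef Y 0 f = (-1) ^+ l * (psi f).@[pt Y].
Proof. by rewrite /lcoef subn0 coef_line. Qed.

Lemma horner_lcoef Y f s : (psi f).@[pt (Y * ('X - (s + 1)%:P))] =
  \sum_(j < l.+1) s ^+ (l - j) * lcoef Y j f.
Proof.
rewrite -horner_line (horner_coef_wide _ (size_line _ (psi_homog f))).
rewrite (reindex_inj rev_ord_inj) /=; apply: eq_bigr => j _.
by rewrite subSS mulrC.
Qed.

(** [Hop_root] relates the values of [psi f] at the roots [y + 1] and [y - 1] to that of
    [psi (B(y) f)] at [y]. Expanded by [horner_lcoef], they involve powers of [y], [y - 2] and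
    [y - 1], which is the operator [D] applied to monomials. *)
Lemma lcoef_Dop (Y : {poly K}) f i : (size Y < n)%N ->
  \sum_(j < l.+1) lcoef Y j ((D 'X^(l - j))`_i * f) = 0.
Proof.
move=> Yn.
apply: (@functionals_coef_eq0 K N l.+1 (fun j u => lcoef Y j (u * f))
  (fun j => D 'X^(l - j))) => [j c u v|y].
  by rewrite mulrDl -scalerAl lcoef_linear.
have E j : lcoef Y j ((D 'X^(l - j)).[y%:MP] * f) = d.[y] * (y ^+ (l - j) * lcoef Y j f)
   - (y - 1) ^+ (l - j) * lcoef Y j ((betaP hv).[y%:MP] * f)
   + a.[y] * ((y - 2) ^+ (l - j) * lcoef Y j f).
  have two : 2 = 2%:MP :> P by rewrite mpolyC_nat.
  rewrite horner_Dop !hornerXn !horner_map /= two -[1]mpolyC1 -!mpolyCB -!rmorphXn /=.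
  rewrite mulrDl mulrBl -!mpolyCM !mul_mpolyC [_ * _%:MP]mulrC mul_mpolyC -scalerAl.
  set u := _ * f; rewrite addrC -[X in X + _]addr0 addrC.
  rewrite addrAC addr0 -scaleNr addrC lcoef_linear addrC lcoef_linear.
  rewrite -[_ *: f]addr0 lcoef_linear.
  have -> : lcoef Y j 0 = 0 by rewrite /lcoef psi0 /line mmap0 coef0.
  by ring.
under eq_bigr do rewrite E.
rewrite big_split sumrB -!mulr_sumr -horner_lcoef.
have -> : \sum_(j < l.+1) (y - 1) ^+ (l - j) * lcoef Y j ((betaP hv).[y%:MP] * f) =
    (psi ((betaP hv).[y%:MP] * f)).@[pt (Y * ('X - y%:P))].
  by rewrite -horner_lcoef subrK.
have -> : \sum_(j < l.+1) (y - 2) ^+ (l - j) * lcoef Y j f =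
    (psi f).@[pt (Y * ('X - (y - 1)%:P))].
  by rewrite -horner_lcoef; congr (meval (pt (_ * ('X - _%:P))) _); ring.
have psi_sum (F : 'I_n.+1 -> P) (c : 'I_n.+1 -> K) :
    psi (\sum_i c i *: F i) = \sum_i c i *: psi (F i).
  by elim/big_rec2: _ => [|i' u v _ <-]; rewrite ?psi0 ?psi_linear.
have -> : (betaP hv).[y%:MP] * f = \sum_(i < n.+1) y ^+ i *: ((betaP hv)`_i * f).
  rewrite (horner_coef_wide _ (size_betaP hv)) mulr_suml; apply: eq_bigr => i' _.
  by rewrite -rmorphXn mulrAC mulrC mul_mpolyC.
rewrite psi_sum; set S := meval _ (\sum_(i < n.+1) _).
have -> : S = \sum_(i < n.+1) y ^+ i * (Hop z T i (psi f)).@[pt (Y * ('X - y%:P))].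
  rewrite /S raddf_sum; apply: eq_bigr => i' _.
  by rewrite /= mevalZ psi_Hop // -ltnS.
by rewrite (Hop_root TH) //=; ring.
Qed.

Variable c : nat -> P.
Hypothesis c0 : c 0%N = 1.
Hypothesis cE : forall k, (1 <= k <= l)%N -> \sum_(j < k.+1) c j * Ecoef k j = 0.
Local Notation pc := (\sum_(j < l.+1) c j *: 'X^(l - j)).

(** [lcoef_Dop] and the equations for [c] are the same triangular system, so [triangular_unique]
    applies to the functionals [lcoef Y j]. *)
Lemma lcoefE (Y : {poly K}) k f : (size Y < n)%N -> (k <= l)%N ->
  lcoef Y k f = lcoef Y 0 (c k * f).
Proof.
move=> Yn kl; pose F j : {scalar P} := HB.pack (lcoef Y j)
  (GRing.isLinear.Build K P K *%R (lcoef Y j) (lcoef_linear Y j)).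
apply: (@triangular_unique _ _ l Ecoef ediag _ _ c F c0 cE _ k f kl).
- by move=> k' /andP[_ kl']; apply: Ecoef_diag.
- by move=> k' kl'; apply: ediag_neq0.
move=> k' f' /andP[k1 kl']; rewrite -[RHS](@lcoef_Dop Y f' (l + n - 2 - k')) //.
rewrite (@big_Ecoef _ k' (fun j u => lcoef Y j (u * f'))) // => j.
by rewrite mul0r /lcoef psi0 /line mmap0 coef0.
Qed.

(** The expansion [horner_lcoef] at [s = y - 1], with every coefficient moved to index [0] by
    [lcoefE]: a root is traded for a value of [pc]. *)
Lemma psi_step (Y : {poly K}) y f : (size Y < n)%N ->
  (psi f).@[pt (Y * ('X - y%:P))] = (-1) ^+ l * (psi (pc.[(y - 1)%:MP] * f)).@[pt Y].
Proof.
move=> Yn; have := horner_lcoef Y f (y - 1); rewrite subrK => ->.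
rewrite -lcoef0 horner_sum mulr_suml.
pose F j : {scalar P} := HB.pack (lcoef Y j)
  (GRing.isLinear.Build K P K *%R (lcoef Y j) (lcoef_linear Y j)).
rewrite -[lcoef Y 0]/(F 0%N : P -> K) linear_sum; apply: eq_bigr => j _.
rewrite lcoefE ?(leq_trans _ (ltnSE (ltn_ord j))) //.
by rewrite hornerZ hornerXn -rmorphXn /= mulrAC [c j * f * _]mulrC mul_mpolyC -lcoefZ.
Qed.

Lemma psi_roots (s : seq K) f : (size s < n)%N ->
  (psi f).@[pt (roots_poly s)] =
  (-1) ^+ (l * size s) * (psi (\prod_(y <- s) pc.[(y - 1)%:MP] * f)).@[pt 1].
Proof.
elim: s f => [|y s IH] f sn; first by rewrite !big_nil muln0 expr0 !mul1r.
rewrite !big_cons mulrC psi_step ?size_prod_XsubC // IH; last exact: ltnW.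
rewrite mulrA -exprD /= mulnS; congr (_ * meval _ (psi _)).
by rewrite mulrCA mulrA.
Qed.

(** [lcoef_Dop] at [Y = 1], with every coefficient moved to index [0]. It will show that the
    functional built from [psi] kills the relations [q_k] with [k >= 3]. *)
Lemma psi_Dop f i : (psi ((D pc)`_i * f)).@[pt 1] = 0.
Proof.
pose Y1 : {poly K} := 1; have n1 : (size Y1 < n)%N by rewrite size_poly1.
apply: (@mulfI _ ((-1) ^+ l)); first by rewrite signr_eq0.
rewrite mulr0 -lcoef0 coef_Dop_sum mulr_suml -[RHS](lcoef_Dop f i n1).
pose F j : {scalar P} := HB.pack (lcoef Y1 j)
  (GRing.isLinear.Build K P K *%R (lcoef Y1 j) (lcoef_linear Y1 j)).
rewrite -[lcoef Y1 0]/(F 0%N : P -> K) linear_sum; apply: eq_bigr => j _.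
by rewrite lcoefE ?(ltnSE (ltn_ord j)) // mulrA.
Qed.

End Recursion.

(** * The weight function and the algebra A_D *)

Section GenericPolynomials.
Variables (K : numFieldType) (n l : nat).
Local Notation Cah := {mpoly K[l + n]}.

(** The convention [a_0 = 1] makes [p] a uniform sum, matching [c 0 = 1] in the recursion. *)
Definition a_coef k : Cah := if k is 0%N then 1 else a_var K n l k.

Lemma a_varE (i : 'I_l) : a_var K n l i.+1 = 'X_(lshift n i).
Proof. by rewrite /a_var (big_pred1 i) // => j; rewrite /= eqSS. Qed.

Lemma h_varE (i : 'I_n) : h_var K n l i.+1 = 'X_(rshift l i).
Proof. by rewrite /h_var (big_pred1 i) // => j; rewrite /= eqSS. Qed.

Lemma p_polyE : p_poly K n l = \sum_(j < l.+1) a_coef j *: 'X^(l - j).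
Proof.
rewrite /p_poly big_ord_recl subn0 scale1r; congr (_ + _).
by rewrite big_add1 big_mkord.
Qed.

Lemma B_polyE : B_poly K n l = betaP (fun k => 'X_(rshift l k)).
Proof.
rewrite /B_poly /betaP; congr (_ + _); rewrite big_add1 big_mkord.
by apply: eq_bigr => k _; rewrite h_varE; congr (_ *: 'X^_); rewrite subnS predn_sub.
Qed.

(** Substituting [y_0 = c] and the entries of [s] for the other [y_j] turns [x_of_y] into the
    coefficients of [c * roots_poly s]. *)
Lemma weight_eval (w : {mpoly Cah[n]}) (c : K) (s : seq K) :
  is_weight_function w -> size s = n.-1 ->
  w.@[fun k => (pt (c *: roots_poly s) k)%:MP] =
  (c ^+ l)%:MP * \prod_(y <- s) (p_poly K n l).[(y - 1)%:MP].
Proof.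
move=> [_ E] sz; pose v (i : 'I_n.-1.+1) : Cah := (nth 0 (c :: s) i)%:MP.
have := congr1 (meval v) E; rewrite comp_mpoly_meval.
have mapC (q : {poly Cah}) : map_poly (meval v) (map_poly (@mpolyC n.-1.+1 Cah) q) = q.
  by apply/polyP=> i; rewrite !coef_map /= mevalC.
have vy j : meval v (y_var K l j) = (s`_j)%:MP.
  by rewrite /y_var mevalXU /v lift0.
have -> : w.@[fun i => (tnth (x_of_y K n l) i).@[v]] =
    w.@[fun k => (pt (c *: roots_poly s) k)%:MP].
  apply: meval_eq => k; rewrite tnth_mktuple /pt -[LHS](coef_map (meval v)) -[RHS](coef_map
    (@mpolyC (l + n) K)).
  congr (_`_(_)).
  rewrite !map_polyZ /= mevalXU.
  suff -> : map_poly (meval v) (\prod_(j < n.-1) ('X - (y_var K l j)%:P)) =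
    map_poly (@mpolyC (l + n) K) (roots_poly s) by [].
  rewrite !rmorph_prod /= (big_nth 0) big_mkord sz; apply: eq_bigr => j _.
  by rewrite !rmorphB /= !map_polyX !map_polyC /= vy.
move=> ->; rewrite mevalM rmorphXn /= mevalXU /v /= rmorphXn /=; congr (_ * _).
rewrite rmorph_prod (big_nth 0) big_mkord sz; apply: eq_bigr => j _.
rewrite -[LHS](horner_map (meval v)) mapC /= mevalB meval1 vy.
by rewrite mpolyCB mpolyC1.
Qed.

Definition contract (G : Cah -> K) (w : {mpoly Cah[n]}) : {mpoly K[n]} := map_mpoly G w.

Lemma meval_contract (G : Cah -> K) (w : {mpoly Cah[n]}) x :
  (forall c u v, G (c *: u + v) = c * G u + G v) ->
  (contract G w).@[x] = G w.@[fun k => (x k)%:MP].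
Proof.
move=> GD; rewrite [in RHS]mevalE /contract /map_mpoly /mmap raddf_sum.
elim/big_rec2: _ => [|k u v _ ->].
  by have := GD (-1) 0 0; rewrite scaler0 addr0 mulN1r addNr.
have -> : w@_k * \prod_(i < n) (x i)%:MP ^+ k i = (\prod_(i < n) x i ^+ k i) *: w@_k.
  rewrite -mul_mpolyC mulrC rmorph_prod; congr (_ * _).
  by apply: eq_bigr => i _; rewrite rmorphXn.
by rewrite GD /= mevalM mevalC mulrC mmap1_id mevalX.
Qed.

End GenericPolynomials.

(** * Surjectivity *)

Section Functionals.
Variables (K : numFieldType) (n l : nat) (z m : 'I_n -> K).
Local Notation Cah := {mpoly K[l + n]}.

Lemma I_D_mulq k (f : Cah) : (1 <= k <= l + n)%N -> f * q_rel l z m k \in I_D z m.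
Proof.
move=> kl; apply/asboolP; exists (fun i => if i == k then f else 0).
rewrite (bigD1_seq k) ?iota_uniq ?mem_index_iota //= eqxx big1 ?addr0 // => i ik.
by rewrite (negPf ik) mul0r.
Qed.

Lemma proj_D_eq0 (f : Cah) : f \in I_D z m -> proj_D z m f = 0.
Proof. by move=> fI; rewrite -(raddf0 (@proj_D K n l z m)); apply/eq_proj_D; rewrite subr0.
  Qed.

(** A functional vanishing on all multiples of the generators vanishes on the ideal, so its value on
    a representative depends only on the class. *)
Lemma functional_lift (G : Cah -> K) :
  (forall c u v, G (c *: u + v) = c * G u + G v) ->
  (forall k f, (1 <= k <= l + n)%N -> G (f * q_rel l z m k) = 0) ->
  exists g : {scalar A_D l z m}, forall f, g (proj_D z m f) = G f.
Proof.
move=> GD Gq.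
have G0 : G 0 = 0 by have := GD (-1) 0 0; rewrite scaler0 addr0 mulN1r addNr.
have GI f : f \in I_D z m -> G f = 0.
  case/asboolP => c ->; rewrite big_seq; elim/big_rec: _ => // k u.
  rewrite mem_index_iota ltnS => kl IH.
  by have := GD 1 (c k * q_rel l z m k) u; rewrite scale1r IH Gq // mulr0 addr0.
have Gproj f f' : proj_D z m f = proj_D z m f' -> G f = G f'.
  move/eq_proj_D/GI; have := GD 1 (f - f') f'; rewrite scale1r subrK mul1r => -> ->.
  by rewrite add0r.
pose gf (x : A_D l z m) : K := G (repr (x : Quotient.quot (I_D z m))).
have gfE f : gf (proj_D z m f) = G f.
  by apply: Gproj; rewrite /proj_D reprK.
have gfD c x y : gf (c *: x + y) = c * gf x + gf y.
  have [f ->] := proj_D_surj x; have [f' ->] := proj_D_surj y.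
  by rewrite -linearP !gfE GD.
pose g : {scalar A_D l z m} := HB.pack gf (GRing.isLinear.Build K (A_D l z m) K *%R gf gfD).
by exists g => f; apply: gfE.
Qed.

Lemma q_rel1 : (0 < n)%N -> exists2 k : 'I_n, val k = 0%N &
  q_rel l z m 1 = 'X_(rshift l k) - (\sum_(i < n) (m i - 2 * z i))%:MP.
Proof. by move=> n0; exists (Ordinal n0); rewrite // /q_rel eqxx -h_varE. Qed.

Lemma q_rel2 : (1 < n)%N -> exists2 k : 'I_n, val k = 1%N &
  q_rel l z m 2 = 'X_(rshift l k) - (h2c z m l)%:MP.
Proof.
move=> n1; exists (Ordinal n1) => //.
by rewrite /q_rel /= h2cE // mpolyCD opprD addrA -h_varE.
Qed.

End Functionals.

Section Surjectivity.
Variables (K : numFieldType) (n l : nat) (z m : 'I_n -> K).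
Variable T : 'I_2 -> 'I_2 -> nat -> {linear {mpoly K[n]} -> {mpoly K[n]}}.
Variable w : {mpoly {mpoly K[l + n]}[n]}.
Hypotheses (n_ge2 : (2 <= n)%N) (sep : separating l m).
Hypotheses (TH : holomorphic_rep z m T) (wW : is_weight_function w).
(** Discharged at the end by [pt_roots_eq0], where the field is algebraically closed. *)
Hypothesis pt_dense : forall p : {mpoly K[n]},
  (forall c (s : seq K), size s = n.-1 -> uniq s -> p.@[pt (c *: roots_poly s)] = 0) -> p = 0.
Local Notation Cah := {mpoly K[l + n]}.
Local Notation P := {mpoly K[n]}.
Local Notation d := (d_poly z).
Local Notation a := (a_poly z m).

Lemma sing_Hop2 p : sing l T p -> Hop z T (n - 2) p = h2c z m l *: p.
Proof.
case=> pl pe; have n0 : (0 < n)%N by lia.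
have := e12_eq n_ge2 TH (i0 := Ordinal n0) erefl pl.
by rewrite pe mulr0 => /esym/subr0_eq.
Qed.

Lemma sing_Hop i p : sing l T p -> sing l T (Hop z T i p).
Proof.
case=> pl pe; split; first exact: (Hop_dhomog TH).
by rewrite (e12_Hop TH) pe Hop0.
Qed.

(** The images of [h_1], ..., [h_n] in the polynomial ring acting on [p]; the first two are the
    constants forced by [Hop_n1] and by singularity. *)
Definition hconst (k : 'I_n) : P :=
  if val k == 0%N then ((a + d)`_n.-1)%:MP
  else if val k == 1%N then (h2c z m l)%:MP else 'X_k.

Lemma tau_surjective p : sing l T p -> exists g : {scalar A_D l z m}, tau w g = p.
Proof.
move=> p_sing.
have theta_lin k := @Hop_linear _ _ z T (n.-1 - k).
have theta_com (i j : 'I_n) v : Hop z T (n.-1 - i) (Hop z T (n.-1 - j) v) =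
   Hop z T (n.-1 - j) (Hop z T (n.-1 - i) v) by apply: (Hop_comm TH).
(* [act f] is [f] in the commuting operators [Hop (n.-1 - k)], applied to [p]. *)
have [act [act_lin act1 actX]] := @mpoly_action K P n (fun k => Hop z T (n.-1 - k)) theta_lin
  theta_com p.
have act_sing f : sing l T (act f).
  elim/mpoly_mulX_ind: f => [|c f g [fl fe] [gl ge]|i f IH]; first by rewrite act1.
    rewrite act_lin; split; first by rewrite rpredD ?rpredZ.
    by rewrite linearP /= fe ge scaler0 addr0.
  by rewrite actX; apply: sing_Hop.
have act0 : act 0 = 0 by have := act_lin (-1) 0 0; rewrite scaler0 addr0 scaleN1r addNr.
have actC c f : act (c%:MP * f) = c *: act f.
  by rewrite mul_mpolyC; have := act_lin c f 0; rewrite act0 !addr0.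
have act_Hop i f : (i <= n)%N -> Hop z T i (act f) = act ((betaP hconst)`_i * f).
  rewrite leq_eqVlt => /orP[/eqP -> | lt_in].
    have two : 2 = 2%:MP :> P by rewrite mpolyC_nat.
    by rewrite coef_betaP_n // two actC; apply: (Hop_n n_ge2 TH).
  pose k := rev_ord (Ordinal lt_in).
  have iE : i = (n.-1 - k)%N by rewrite /=; lia.
  rewrite {2}iE coef_betaP // /hconst; have [k0|_] := eqVneq (val k) 0%N.
    by rewrite actC iE [X in (_ - X)%N]k0 subn0; apply: (Hop_n1 n_ge2 TH).
  have [k1|_] := eqVneq (val k) 1%N; last by rewrite actX -iE.
  rewrite actC iE [X in (_ - X)%N]k1 (_ : n.-1 - 1 = n - 2)%N; last by lia.
  exact: sing_Hop2.
have act_homog f : act f \is l.-homog by case: (act_sing f).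
have h0 (k : 'I_n) : val k = 0%N -> hconst k = ((a + d)`_n.-1)%:MP by rewrite /hconst => ->.
have h1 (k : 'I_n) : val k = 1%N -> hconst k = (h2c z m l)%:MP by rewrite /hconst => ->.
have Ed k : (1 <= k <= l)%N -> Ecoef l z m hconst k k = (ediag l m k)%:A.
  by move=> /andP[_ kl]; apply: Ecoef_diag.
have [c c0 cE] := triangular_solution Ed (ediag_neq0 sep).
have [theta [th_h th_a thC]] : exists theta : {rmorphism Cah -> P},
    [/\ forall k, theta 'X_(rshift l k) = hconst k,
        forall j, (j <= l)%N -> theta (a_coef K n l j) = c j & forall x, theta x%:MP = x%:MP].
  pose th (i : 'I_(l + n)) : P := match split i with inl j => c j.+1 | inr k => hconst k end.
  exists (mmap (@mpolyC n K) th); split=> [k|j|x].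
  - by rewrite /= mmapX mmap1U /th (unsplitK (inr k)).
  - case: j => [|j] jl; first by rewrite rmorph1 c0.
    by rewrite /a_coef (a_varE _ _ (Ordinal jl)) /= mmapX mmap1U /th (unsplitK (inl _)).
  - by rewrite /= mmapC.
pose pc := \sum_(j < l.+1) c j *: 'X^(l - j).
have th_p : map_poly theta (p_poly K n l) = pc.
  rewrite p_polyE rmorph_sum; apply: eq_bigr => j _.
  by rewrite /= map_polyZ map_polyXn th_a // -ltnS.
have th_B : map_poly theta (B_poly K n l) = betaP hconst.
  rewrite B_polyE rmorphD rmorph_sum /= map_polyZ map_polyXn rmorph_nat; congr (_ + _).
  by apply: eq_bigr => k _; rewrite map_polyZ map_polyXn /= th_h.
have th_C (q : {poly K}) : map_poly theta (map_poly (@mpolyC _ _) q) = map_poly (@mpolyC n K)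
  q.
  by apply/polyP=> i; rewrite !coef_map; apply: thC.
have th_D : map_poly theta (difference_poly l z m) =
    Dop (map_poly (@mpolyC n K) d) (map_poly (@mpolyC n K) a) (betaP hconst) pc.
  rewrite -th_p -th_B -(th_C d) -(th_C a); exact: map_Dop.
have n0 : (0 < n)%N by lia.
(* The sign compensates the one in [psi_roots] for [n - 1] roots. *)
pose G (x : Cah) := (-1) ^+ (l * n.-1) * (act (theta x)).@[pt 1].
have thZ x u : theta (x *: u) = x *: theta u by rewrite -!mul_mpolyC rmorphM /= thC.
have GD x u v : G (x *: u + v) = x * G u + G v.
  by rewrite /G rmorphD /= thZ act_lin mevalD mevalZ mulrDr mulrCA.
have Gq k f : (1 <= k <= l + n)%N -> G (f * q_rel l z m k) = 0.
  move=> kl; rewrite /G rmorphM /=.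
  have [k1|k1] := eqVneq k 1%N.
    have [i i0 E] := q_rel1 l z m n0.
    rewrite k1 E rmorphB /= th_h thC h0 // (coef_ad_n1 n_ge2) subrr mulr0.
    by rewrite act0 meval0 mulr0.
  have [k2|k2] := eqVneq k 2%N.
    have [i i1 E] := q_rel2 l z m n_ge2.
    by rewrite k2 E rmorphB /= th_h thC h1 // subrr mulr0 act0 meval0 mulr0.
  rewrite /q_rel (negPf k1) (negPf k2) -coef_map th_D [theta f * _]mulrC.
  by rewrite (psi_Dop n_ge2 h0 h1 TH sep act_lin act_homog act_Hop c0 cE) mulr0.
have [g gE] := functional_lift GD Gq; exists g.
(* At points with [n - 1] distinct roots, [weight_eval] and [psi_roots] produce the same product of
   values of [pc]. *)
apply/subr0_eq/pt_dense => e s sz us; rewrite mevalB -[tau w g]/(contract _ w).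
rewrite meval_contract => [|x u v]; last by rewrite !gE GD.
rewrite (weight_eval e wW sz) gE /G rmorphM /= thC rmorph_prod.
have -> : \prod_(y <- s) theta (p_poly K n l).[(y - 1)%:MP] = \prod_(y <- s) pc.[(y - 1)%:MP].
  by apply: eq_bigr => y _; rewrite -horner_map th_p thC.
rewrite mul_mpolyC -[_ *: _]addr0 act_lin act0 addr0 mevalZ.
have [pl _] := p_sing; rewrite (dhomog_meval_scale _ _ pl) -act1.
have sn : (size s < n)%N by rewrite sz; lia.
rewrite (psi_roots n_ge2 h0 h1 TH sep act_lin act_homog act_Hop c0 cE _ sn) sz mulr1.
by rewrite mulrCA subrr.
Qed.

End Surjectivity.

(** * Injectivity *)

Section Image.
Variables (K : numFieldType) (n l : nat) (z m : 'I_n -> K).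
Variable T : 'I_2 -> 'I_2 -> nat -> {linear {mpoly K[n]} -> {mpoly K[n]}}.
Variable w : {mpoly {mpoly K[l + n]}[n]}.
Hypotheses (n_ge2 : (2 <= n)%N) (sep : separating l m).
Hypotheses (TH : holomorphic_rep z m T) (wW : is_weight_function w).
Hypothesis pt_dense : forall p : {mpoly K[n]},
  (forall c (s : seq K), size s = n.-1 -> uniq s -> p.@[pt (c *: roots_poly s)] = 0) -> p = 0.
Local Notation Cah := {mpoly K[l + n]}.
Local Notation d := (d_poly z).
Local Notation a := (a_poly z m).
Local Notation p_ := (p_poly K n l).
Local Notation iota := (map_poly (@mpolyC (l + n) K)).
Variable g : {scalar A_D l z m}.

Let G (f : Cah) : K := g (proj_D z m f).

Let GD c u v : G (c *: u + v) = c * G u + G v.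
Proof. by rewrite /G !linearP. Qed.

Let G0 : G 0 = 0.
Proof. by rewrite /G !linear0. Qed.

Let Gadd u v : G (u + v) = G u + G v.
Proof. by have := GD 1 u v; rewrite scale1r mul1r. Qed.

Let GZ c u : G (c *: u) = c * G u.
Proof. by have := GD c u 0; rewrite G0 !addr0. Qed.

Let Gq k f : (1 <= k <= l + n)%N -> G (f * q_rel l z m k) = 0.
Proof. by move=> kl; rewrite /G proj_D_eq0 ?linear0 //; apply: I_D_mulq. Qed.

(** Equal to [h_k] modulo [I_D]; with true constants in the first two places the triangularity of
    [D] holds exactly, before any quotient is taken. *)
Definition hred (k : 'I_n) : Cah :=
  if val k == 0%N then ((a + d)`_n.-1)%:MP
  else if val k == 1%N then (h2c z m l)%:MP else 'X_(rshift l k).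

Let hred0 (k : 'I_n) : val k = 0%N -> hred k = ((a + d)`_n.-1)%:MP.
Proof. by rewrite /hred => ->. Qed.

Let hred1 (k : 'I_n) : val k = 1%N -> hred k = (h2c z m l)%:MP.
Proof. by rewrite /hred => ->. Qed.

Local Notation D := (Dop (iota d) (iota a) (betaP hred)).

Let G_beta t f : G (f * (B_poly K n l - betaP hred)`_t) = 0.
Proof.
have n0 : (0 < n)%N by lia.
rewrite B_polyE coefB; have [tn | nt] := ltnP n t.
  by rewrite !nth_default ?subrr ?mulr0 ?G0 // (leq_trans (size_betaP _ _)).
move: nt; rewrite leq_eqVlt => /orP[/eqP -> | lt_tn].
  by rewrite !coef_betaP_n // subrr mulr0 G0.
pose k := rev_ord (Ordinal lt_tn).
have -> : t = (n.-1 - k)%N by rewrite /=; lia.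
rewrite !coef_betaP //; have [k0|k0] := eqVneq (val k) 0%N.
  have [i i0 E] := q_rel1 l z m n0; have <- : i = k by apply: val_inj; rewrite i0 k0.
  by rewrite hred0 // (coef_ad_n1 n_ge2) -E Gq //; lia.
have [k1|k1] := eqVneq (val k) 1%N.
  have [i i1 E] := q_rel2 l z m n_ge2; have <- : i = k by apply: val_inj; rewrite i1 k1.
  by rewrite hred1 // -E Gq //; lia.
by rewrite /hred (negPf k0) (negPf k1) subrr mulr0 G0.
Qed.

Let G_sum (I : Type) (s : seq I) (F : I -> Cah) : G (\sum_(i <- s) F i) = \sum_(i <- s) G (F
  i).
Proof. by elim/big_rec2: _ => [|i u v _ <-]; rewrite ?G0 ?Gadd. Qed.

(** From degree [l + n - 2] on, the coefficients vanish by the choice of [hred]. Below, they are the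
    relations [q_k] with [k >= 3], up to the change of [B] that [G_beta] absorbs. *)
Let G_Dop i f : G (f * (D p_)`_i) = 0.
Proof.
have [hi | lo] := leqP (l + n - 2) i.
  by rewrite p_polyE (coef_Dop_sum_high n_ge2 hred0 hred1) ?mulr0 ?G0.
rewrite (Dop_change _ _ _ (B_poly K n l)) -[Dop _ _ (B_poly K n l) _]/(difference_poly l z m).
rewrite coefD mulrDr Gadd coefM mulr_sumr G_sum [X in _ + X]big1 ?addr0 => [|t _].
  rewrite -[RHS](@Gq (l + n - i)%N f); last by lia.
  have k1 : (l + n - i == 1)%N = false by lia.
  have k2 : (l + n - i == 2)%N = false by lia.
  have k3 : (l + n - (l + n - i) = i)%N by lia.
  by rewrite /q_rel k1 k2 k3.
have E (u v : Cah) : G (f * (u * v)) = G (f * v * u) by rewrite -mulrA [v * u]mulrC.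
by apply: etrans (E _ _) _; apply: G_beta.
Qed.

Definition psi (f : Cah) : {mpoly K[n]} := contract (fun c => G (f * c)) w.

Let GfD f c u v : G (f * (c *: u + v)) = c * G (f * u) + G (f * v).
Proof. by rewrite mulrDr -scalerAr GD. Qed.

Lemma mcoeff_psi f k : (psi f)@_k = G (f * w@_k).
Proof.
rewrite /psi /contract /map_mpoly /mmap raddf_sum.
have -> : w@_k = \sum_(j <- msupp w) (j == k)%:R *: w@_j.
  have [kw | kw] := boolP (k \in msupp w).
    rewrite (bigD1_seq k) ?msupp_uniq //= eqxx scale1r big1 ?addr0 // => j jk.
    by rewrite (negPf jk) scale0r.
  rewrite memN_msupp_eq0 // big_seq big1 // => j jw.
  by case: eqP => [E|]; rewrite ?scale0r //; rewrite -E jw in kw.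
rewrite mulr_sumr G_sum; apply: eq_bigr => j _.
by rewrite -scalerAr GZ /= mmap1_id mcoeffCM mcoeffX mulrC.
Qed.

Lemma psi_linear c f h : psi (c *: f + h) = c *: psi f + psi h.
Proof.
apply/mpolyP => k; rewrite mcoeffD mcoeffZ !mcoeff_psi.
by rewrite mulrDl -scalerAl GD.
Qed.

Lemma psi_homog f : psi f \is l.-homog.
Proof.
have [wl _] := wW; apply/dhomogP => k; rewrite mcoeff_msupp mcoeff_psi => fk.
apply: (dhomog_mf wl); rewrite mcoeff_msupp; apply: contra_neq fk => ->.
by rewrite mulr0 G0.
Qed.

Lemma psi_eval c (s : seq K) f : size s = n.-1 ->
  (psi f).@[pt (c *: roots_poly s)] = c ^+ l * G (f * \prod_(y <- s) p_.[(y - 1)%:MP]).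
Proof.
move=> sz; rewrite /psi meval_contract => [|e u v]; last exact: GfD.
by rewrite (weight_eval c wW sz) mul_mpolyC -scalerAr GZ.
Qed.

Lemma psiZ c f : psi (c%:MP * f) = c *: psi f.
Proof.
by apply/mpolyP=> k; rewrite mcoeffZ !mcoeff_psi mul_mpolyC -scalerAl GZ.
Qed.

Let G_Dop_at (y : K) F : G (F * (D p_).[y%:MP]) = 0.
Proof.
rewrite horner_coef mulr_sumr G_sum big1 // => i _.
have E (u : Cah) e : G (F * (u * e%:MP)) = e * G (F * u).
  by rewrite mulrA [F * u * _]mulrC mul_mpolyC GZ.
by rewrite -rmorphXn; apply: etrans (E _ _) _; rewrite G_Dop mulr0.
Qed.

(** At [X] with distinct roots, [R] collects the differences of both sides as coefficients. Its
    terms in [u^n] and [u^(n-1)] vanish, both operators being scalars there, and it has [n - 1]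
    roots by the difference equation, so it is zero. *)
Lemma psi_Hop i f : (i <= n)%N -> Hop z T i (psi f) = psi ((betaP hred)`_i * f).
Proof.
have n0 : (0 < n)%N by lia.
pose chi j := Hop z T j (psi f) - psi ((betaP hred)`_j * f).
have chi_n : chi n = 0.
  have two : 2 = 2%:MP :> Cah by rewrite mpolyC_nat.
  by rewrite /chi (Hop_n n_ge2 TH) coef_betaP_n // two psiZ subrr.
have chi_n1 : chi n.-1 = 0.
  rewrite /chi (Hop_n1 n_ge2 TH) [X in (betaP hred)`_X](_ : _ = n.-1 - Ordinal n0)%N; last by
    rewrite subn0.
  by rewrite coef_betaP // hred0 // psiZ subrr.
move=> i_n; apply/subr0_eq; rewrite -/(chi i); apply: pt_dense => c s sz us.
set X := c *: _; pose R := \poly_(j < n.+1) (chi j).@[pt X].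
suff /(congr1 (fun q : {poly K} => q`_i)) : R = 0 by rewrite coef0 coef_poly ltnS i_n.
have szR : (size R <= size s)%N.
  rewrite sz; apply/leq_sizeP => j nj; rewrite coef_poly.
  case: ltnP => // jn; have [->|jn1] := eqVneq j n; first by rewrite chi_n meval0.
  by rewrite (_ : j = n.-1) ?chi_n1 ?meval0 //; lia.
apply/eqP/negPn/negP => R0; suff rs : all (root R) s.
  by have := max_poly_roots R0 rs us; rewrite ltnNge szR.
(* At a root [y], [Hop_root] and [psi_eval] bring in the values of [p] at [y - 2], [y - 1] and [y],
   which are related by [G_Dop_at]. *)
apply/allP => y ys; apply/rootP; rewrite horner_poly /chi.
pose Y := c *: roots_poly (rem y s).
have XY : X = Y * ('X - y%:P).
  by rewrite /X /Y (perm_big _ (perm_to_rem ys)) big_cons -scalerAl mulrC.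
have szr : (size (rem y s)).+1 = n.-1 by rewrite size_rem // sz prednK //; lia.
have Yn : (size Y < n)%N.
  by rewrite (leq_ltn_trans (size_scale_leq _ _)) // size_prod_XsubC szr; lia.
pose Pi := \prod_(x <- rem y s) p_.[(x - 1)%:MP].
have Yev h y' : (psi h).@[pt (Y * ('X - y'%:P))] = c ^+ l * G (h * (Pi * p_.[(y' - 1)%:MP])).
  rewrite [Pi * _]mulrC; have := @psi_eval c (y' :: rem y s) h szr; rewrite !big_cons => <-.
  by rewrite /Y -scalerAl [_ * ('X - _)]mulrC.
have sum1 : \sum_(j < n.+1) (Hop z T j (psi f)).@[pt X] * y ^+ j =
    a.[y] * (c ^+ l * G (f * (Pi * p_.[(y - 2)%:MP]))) + d.[y] * (c ^+ l * G (f * (Pi *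
      p_.[y%:MP]))).
  under eq_bigr do rewrite mulrC.
  rewrite XY (Hop_root TH) // !Yev addrK.
  by rewrite (_ : y - 1 - 1 = y - 2) //; ring.
have sum2 : \sum_(j < n.+1) (psi ((betaP hred)`_j * f)).@[pt X] * y ^+ j =
    c ^+ l * G ((betaP hred).[y%:MP] * f * (Pi * p_.[(y - 1)%:MP])).
  rewrite (horner_coef_wide _ (size_betaP n_ge2 hred)) !mulr_suml G_sum mulr_sumr.
  apply: eq_bigr => j _; rewrite XY Yev -(mulrA (c ^+ l)); congr (_ * _).
  have E (u v v' : Cah) e : G (u * v * v') * e = G (u * e%:MP * v * v').
    have -> : u * e%:MP * v * v' = e *: (u * v * v').
      by rewrite -mul_mpolyC !mulrA [e%:MP * u]mulrC.
    by rewrite GZ mulrC.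
  by rewrite -rmorphXn; apply: E.
under eq_bigr do rewrite mevalB mulrBl.
rewrite sumrB sum1 sum2; have := G_Dop_at y (f * Pi).
have two : 2 = 2%:MP :> Cah by rewrite mpolyC_nat.
have one : 1 = 1%:MP :> Cah by rewrite mpolyC1.
rewrite horner_Dop !horner_map /= two one -!mpolyCB.
set A := p_.[_]; set B := p_.[_]; set C := p_.[_]; set be := (betaP hred).[_].
have -> : f * Pi * (d.[y]%:MP * B - be * C + a.[y]%:MP * A) =
    d.[y] *: (f * (Pi * B)) + (- 1) *: (be * f * (Pi * C)) + a.[y] *: (f * (Pi * A)).
  by rewrite scaleN1r -!mul_mpolyC; ring.
rewrite !Gadd !GZ => E.
by rewrite -[RHS](mulr0 (c ^+ l)) -E; ring.
Qed.

(** By [psi_Hop], [Hop (n - 2)] acts as [h_2], that is, as [h2c]. Then [e12_eq] gives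
    [x_1 * e12 T (psi f) = 0], and [x_1] is not a zero divisor. *)
Lemma psi_sing f : sing l T (psi f).
Proof.
split; first exact: psi_homog.
have n0 : (0 < n)%N by lia.
have := @e12_eq _ _ _ _ _ n_ge2 TH l (Ordinal n0) (psi f) erefl (psi_homog f).
have -> : Hop z T (n - 2) (psi f) = h2c z m l *: psi f.
  rewrite psi_Hop ?leq_subr // (_ : n - 2 = n.-1 - Ordinal n_ge2)%N; last by move=> /=; lia.
  by rewrite coef_betaP // hred1 // psiZ.
rewrite subrr => /eqP; rewrite mulf_eq0 => /orP[|/eqP //].
by rewrite -msupp_eq0 msuppX.
Qed.

Let p_horner (t : K) : p_.[t%:MP] = \sum_(j < l.+1) t ^+ (l - j) *: a_coef K n l j.
Proof.
rewrite p_polyE horner_sum; apply: eq_bigr => j _.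
by rewrite hornerZ hornerXn -rmorphXn mulrC mul_mpolyC.
Qed.

(* Letting the roots of X go to infinity one at a time recovers g from psi. *)
Lemma psi_roots_G r (s : seq K) f : (size s + r = n.-1)%N ->
  (psi f).@[pt (roots_poly s)] = (-1) ^+ (l * r) * G (f * \prod_(y <- s) p_.[(y - 1)%:MP]).
Proof.
elim: r s => [|r IH] s sz.
  rewrite muln0 mul1r -[roots_poly s]scale1r psi_eval ?expr1n ?mul1r //.
  by rewrite -sz addn0.
set Pi := \prod_(y <- s) p_.[_].
(* The induction hypothesis with the added root [t + 1] gives the restriction to the line. Its
   coefficient of degree [l], where [a_coef 0 = 1], is compared with [coef_line]. *)
pose R := (-1) ^+ (l * r) *: \sum_(j < l.+1) G (f * Pi * a_coef K n l j) *: 'X^(l - j) : {poly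
  K}.
have QR : line (roots_poly s) (psi f) = R.
  apply/subr0_eq/poly_natP => k; rewrite hornerD hornerN horner_line; set t := k%:R.
  have := IH (t + 1 :: s); rewrite /= !big_cons [_ * roots_poly s]mulrC => ->; last by lia.
  rewrite addrK /R hornerZ -mulrBr horner_sum p_horner -/Pi mulrA mulrAC mulr_sumr G_sum.
  apply/eqP; rewrite mulf_eq0 subr_eq0; apply/orP; right; apply/eqP; apply: eq_bigr => j _.
  by rewrite -scalerAr GZ hornerZ hornerXn mulrC.
have := coef_line (roots_poly s) (psi_homog f); rewrite QR /R coefZ coef_sum big_ord_recl.
rewrite big1 => [|j _]; last first.
  by rewrite coefZ coefXn gtn_eqF ?mulr0 // lift0; have := ltn_ord j; lia.
rewrite subn0 coefZ coefXn eqxx !mulr1 addr0 => /(congr1 ( *%R ((-1) ^+ l))).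
by rewrite !mulrA mulnS exprD => ->; rewrite -expr2 sqrr_sign mul1r.
Qed.

Lemma psi1_eq0 : psi 1 = 0 -> forall f, G f = 0.
Proof.
move=> psi1.
(* Multipliers preserving the kernel of [psi]. They are closed under sums and products, and the
   generators [a_k], [h_k] are shown to be among them. *)
pose S x := forall f, psi f = 0 -> psi (x * f) = 0.
have psi_add u v : psi (u + v) = psi u + psi v.
  by have := psi_linear 1 u v; rewrite !scale1r.
have S_add u v : S u -> S v -> S (u + v).
  by move=> Su Sv f f0; rewrite mulrDl psi_add Su ?Sv ?addr0.
have S_mul u v : S u -> S v -> S (u * v).
  by move=> Su Sv f f0; rewrite -mulrA; apply/Su/Sv.
have S_C c : S c%:MP by move=> f f0; rewrite psiZ f0 scaler0.
have S_0 : S 0 by rewrite -(mpolyC0 (l + n) K).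
have S_sum (I : Type) (s : seq I) (F : I -> Cah) : (forall i, S (F i)) -> S (\sum_(i <- s) F
  i).
  by move=> SF; elim/big_rec: _ => // i u _; apply: S_add.
have S_beta t : S (betaP hred)`_t.
  have [tn|nt] := leqP t n; first by move=> f f0; rewrite -psi_Hop // f0 Hop0.
  by rewrite nth_default // (leq_trans (size_betaP n_ge2 _)).
have S_iota (q : {poly K}) i : S (iota q)`_i by rewrite coef_map; apply: S_C.
have S_DX r i : S (D 'X^r)`_i.
  rewrite Dop_Xn_map coefD coefB -coefN -mulrN.
  apply: (S_add _ _ _ (S_iota _ _)); apply: (S_add _ _ (S_iota _ _)).
  rewrite -rmorphN coefM; apply: S_sum => t; apply: S_mul (S_beta _) (S_iota _ _).
have S_D i : S (D p_)`_i.
  move=> f _; apply/mpolyP=> k; rewrite mcoeff_psi mcoeff0.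
  have E (u v v' : Cah) : G (u * v * v') = G (v * v' * u) by rewrite -mulrA mulrC.
  by apply: etrans (E _ _ _) _; apply: G_Dop.
have S_a k : (k <= l)%N -> S (a_coef K n l k).
  elim/ltn_ind: k => -[|k] IH kl; first by rewrite /= -(mpolyC1 (l + n) K).
  have kk : (1 <= k.+1 <= l)%N by rewrite kl.
  have e0 := ediag_neq0 sep kk.
  (* Coefficient [l + n - 2 - k.+1] of [D p], solved for its diagonal term, expresses [a_(k+1)]
     through the [h_j] and the earlier [a_j]. *)
  have E : (ediag l m k.+1)%:MP * a_coef K n l k.+1 = (D p_)`_(l + n - 2 - k.+1) +
      \sum_(j < k.+1) (- 1)%:MP * (a_coef K n l j * Ecoef l z m hred k.+1 j).
    rewrite p_polyE (coef_Dop_sum _ _ _ _ _).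
    rewrite (@big_Ecoef _ _ _ _ _ _ n_ge2 _ hred0 hred1 _ k.+1 (fun j u => a_coef K n l j *
      u)) //.
      rewrite big_ord_recr /= (Ecoef_diag n_ge2 hred0 hred1) // alg_mpolyC -mulr_sumr.
      by rewrite mpolyCN mpolyC1 mulN1r [RHS]addrC addKr mulrC.
    by move=> j; rewrite mulr0.
  have S_ea : S ((ediag l m k.+1)%:MP * a_coef K n l k.+1).
    rewrite E; apply: (S_add _ _ (S_D _)); apply: S_sum => j; apply: (S_mul _ _ (S_C _)).
    by apply: (S_mul _ _ (IH _ _ _) (S_DX _ _)); have := ltn_ord j; lia.
  rewrite -[a_coef _ _ _ _]mul1r -(mpolyC1 (l + n) K) -(mulVf e0) mpolyCM -mulrA.
  exact: S_mul (S_C _) S_ea.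
have S_q k : (1 <= k <= l + n)%N -> S (q_rel l z m k).
  move=> kl f _; apply/mpolyP=> i; rewrite mcoeff_psi mcoeff0.
  by rewrite -mulrA mulrC Gq.
have n0 : (0 < n)%N by lia.
have S_h (k : 'I_n) : S 'X_(rshift l k).
  have [k0|k0] := eqVneq (val k) 0%N.
    have [i i0 E] := q_rel1 l z m n0; have <- : i = k by apply: val_inj; rewrite i0 k0.
    rewrite -[mpolyX _ _](subrK (\sum_(i < n) (m i - 2 * z i))%:MP) -E.
    by apply: S_add => //; apply: S_q; lia.
  have [k1|k1] := eqVneq (val k) 1%N.
    have [i i1 E] := q_rel2 l z m n_ge2; have <- : i = k by apply: val_inj; rewrite i1 k1.
    rewrite -[mpolyX _ _](subrK (h2c z m l)%:MP) -E.
    by apply: S_add => //; apply: S_q; lia.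
  by have := S_beta (n.-1 - k)%N; rewrite coef_betaP // /hred (negPf k0) (negPf k1).
have S_all x : S x.
  elim/mpoly_mulX_ind: x => [|c u v Su Sv|i u Su]; first by rewrite -(mpolyC1 (l + n) K).
    by rewrite -mul_mpolyC; apply: S_add => //; apply: S_mul.
  apply: S_mul => //; case: (split_ordP i) => j ->; last exact: S_h.
  by rewrite -a_varE; apply: (S_a j.+1).
(* With all roots sent to infinity, [G f] is, up to sign, the value of [psi f] at [X = 1]. *)
move=> f; have := @psi_roots_G n.-1 [::] f erefl.
rewrite !big_nil mulr1 -[f in psi f]mulr1 S_all // meval0 => /esym/eqP.
by rewrite mulf_eq0 signr_eq0 => /eqP.
Qed.
End Image.

Theorem theorem7p3p1 (R : realType) (n l : nat) (z m : 'I_n -> R[i])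
    (T : 'I_2 -> 'I_2 -> nat ->
         {linear {mpoly R[i][n]} -> {mpoly R[i][n]}})
    (w : {mpoly {mpoly R[i][l + n]}[n]}) :
  (2 <= n)%N ->
  separating l m ->
  holomorphic_rep z m T ->
  is_weight_function w ->
  (forall p : {mpoly R[i][n]},
     (exists g : {scalar A_D l z m}, tau w g = p) <-> sing l T p) /\
  (forall g : {scalar A_D l z m}, tau w g = 0 -> forall x, g x = 0).
Proof.
move=> n_ge2 sep TH wW; have n0 : (0 < n)%N by lia.
have dense p := @pt_roots_eq0 R[i] n p n0.
have psi1 g : psi (z := z) (m := m) w g 1 = tau w g.
  by congr (map_mpoly _ w); apply: funext => c; rewrite mul1r.
split=> [p|g g0 x].
  split=> [[g <-]|]; last exact: (tau_surjective n_ge2 sep TH wW dense).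
  by rewrite -psi1; apply: (psi_sing n_ge2 TH wW dense).
have [f ->] := proj_D_surj x.
by apply: (psi1_eq0 n_ge2 sep TH wW dense); rewrite psi1.
Qed.
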